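(* Let $n>m\ge l\ge 0$ be integers. (a) (Complete system of invariants.) Let $(S_1,S_2)$ and $(\hat S_1,\hat S_2)$ be two pairs of subspheres of the Möbius space $S^n$, both in general position, where $S_1,\hat S_1$ are $m$-spheres and $S_2,\hat S_2$ are $l$-spheres. Let $\alpha_1\ge\dots\ge\alpha_{n-m}\ge 0$ and $\hat\alpha_1\ge\dots\ge\hat\alpha_{n-m}\ge0$ be the eigenvalues, counted with multiplicity, of the selfadjoint operators $A$ and $\hat A$ associated with the two pairs. Then there exists $g\in G_n$ with $gS_1=\hat S_1$ and $gS_2=\hat S_2$ if and only if $\alpha_i=\hat\alpha_i$ for all $i=1,\dots,n-m$. (b) (Mutual position.) Let $(S_1,S_2)$ be a pair in general position, with $S_1$ an $m$-sphere and $S_2$ an $l$-sphere, let $W$ and $U$ be the pseudo-euclidean subspaces defining $S_1$ and $S_2$, respectively, and let $\alpha_1$ be the largest eigenvalue of the associated operator $A$. Then the cases of mutual position of the spheres correspond to the cases characterised by the maximal eigenvalue as follows: 1. $\alpha_1>1$ if and only if $U\cap W$ is euclidean (possibly $\{0\}$); in this case $S_1\cap S_2=\emptyset$ and there are hyperspheres $\Sigma_1\supset S_1$, $\Sigma_2\supset S_2$ of $S^n$ with $\Sigma_1\cap\Sigma_2=\emptyset$. 2. $\alpha_1<1$ and $\dim (U\cap W)\ge 2$ if and only if $U\cap W$ is pseudo-euclidean of dimension at least $2$; in this case $S_1\cap S_2$ is a subsphere of dimension $m+l-n\ge 0$. 3. $\alpha_1<1$ and $\dim (U\cap W)=1$ if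 and only if $U\cap W$ is pseudo-euclidean of dimension $1$; in this case $m+l=n-1$, $S_1\cap S_2=\emptyset$, and there are no hyperspheres $\Sigma_1\supset S_1$, $\Sigma_2\supset S_2$ of $S^n$ with $\Sigma_1\cap\Sigma_2=\emptyset$ (the subspheres are interlaced). 4. $\alpha_1=1$ if and only if $U\cap W$ is isotropic; in this case $S_1\cap S_2$ consists of exactly one point.
   Context: Let $V$ be a real vector space of dimension $n+2$ with a non-degenerate symmetric bilinear form $\langle\cdot,\cdot\rangle$ of index one (signature: $n+1$ plus signs, one minus sign). Let $\mathbb P$ be the projective space of one-dimensional subspaces of $V$. The Möbius space is $S^n=\{[x]\in\mathbb P : x\ne0,\ \langle x,x\rangle=0\}$. The Möbius group $G_n$ is the group of all projective transformations of $\mathbb P$ preserving $S^n$; it is $O(n+1,1)/\{1,-1\}$, where $O(n+1,1)$ is the group of linear isometries of $(V,\langle\cdot,\cdot\rangle)$. A linear subspace of $V$ is called euclidean if the form restricted to it is positive definite (the null space $\{0\}$ is counted as euclidean here), pseudo-euclidean if the restricted form is non-degenerate of index $1$, and isotropic if the restricted form is degenerate. $\perp$ denotes the orthogonal complement with respect to $\langle\cdot,\cdot\rangle$. For $0\le k\le n$, a $k$-sphere (subsphere of dimension $k$) of $S^n$ is a set of the form $\{[x]\in S^n : x\in Y\}$ with $Y\subset V$ a pseudo-euclidean linear subspace of dimension $k+2$; $Y$ is uniquely determined and is said to define the $k$-sphere. A $0$-sphere is a set of two points. A hypersphere is an $(n-1)$-sphere. A pair $(S_1,S_2)$, consisting of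 an $m$-sphere $S_1$ and an $l$-sphere $S_2$, is in general position if there is no hypersphere of $S^n$ containing $S_1\cup S_2$. Let $W$ be the $(m+2)$-dimensional pseudo-euclidean subspace defining $S_1$, and $U$ the $(l+2)$-dimensional pseudo-euclidean subspace defining $S_2$. Then $V=W\oplus W^\perp=U\oplus U^\perp$ with $W^\perp,U^\perp$ euclidean, of dimensions $n-m$ and $n-l$. Let $p_{1,2}:U^\perp\to W^\perp$ be the restriction to $U^\perp$ of the orthogonal projection of $V$ onto $W^\perp$, and $p_{2,1}:W^\perp\to U^\perp$ the restriction to $W^\perp$ of the orthogonal projection of $V$ onto $U^\perp$. The operator associated with the pair $(S_1,S_2)$ is $A=p_{1,2}\circ p_{2,1}\in\operatorname{End}(W^\perp)$. It is selfadjoint on the euclidean vector space $W^\perp$ and has $n-m$ real nonnegative eigenvalues, counted with multiplicity.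
   Formalization: In case 3, the claim that there are no disjoint hyperspheres Σ1 ⊃ S1, Σ2 ⊃ S2 is stated only for n > 1: for n = 1 (m = l = 0) hyperspheres are point pairs, so Σ1 = S1 and Σ2 = S2 are disjoint and the claim always fails. *)

(* Defs.v *)
From HB Require Import structures.
From mathcomp Require Import all_boot all_order all_algebra sesquilinear.
From mathcomp Require Import classical_sets reals.

Set Implicit Arguments.
Unset Strict Implicit.
Unset Printing Implicit Defensive.

Import Order.TTheory GRing.Theory Num.Theory passmx.

Local Open Scope classical_set_scope.
Local Open Scope ring_scope.

Section ProjectiveSpace.
Variables (R : realType) (V : vectType R).

(* A point [x] is the line <[x]>, x != 0. *)
Definition proj_point := {L : {vspace V} | \dim L == 1%N}.

Definition projective_transformation (g : proj_point -> proj_point) : Prop :=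
  exists2 f : 'End(V), lker f = 0%VS & forall p, val (g p) = (f @: val p)%VS.

End ProjectiveSpace.

Section Forms.
Variables (R : realType) (V : vectType R) (b : {symmetric V}).
Implicit Types (Y W U N : {vspace V}) (S : set (proj_point V)).

Definition negative_definite Y : Prop := {in Y, forall x, x != 0 -> b x x < 0}.

(* The index of b restricted to Y: the largest dimension of a negative definite
   subspace of Y. *)
Definition has_index Y (q : nat) : Prop :=
  (exists N, [/\ (N <= Y)%VS, negative_definite N & \dim N = q]) /\
  (forall N, (N <= Y)%VS -> negative_definite N -> (\dim N <= q)%N).

Definition nondegenerate_on Y : Prop := (Y :&: orthov b Y = 0)%VS.

Definition euclidean Y : Prop := {in Y, forall x, x != 0 -> 0 < b x x}.

Definition pseudo_euclidean Y : Prop := nondegenerate_on Y /\ has_index Y 1.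

Definition isotropic Y : Prop := ~ nondegenerate_on Y.

Definition moebius_space : set (proj_point V) :=
  [set p | exists x : V, [/\ x != 0, b x x = 0 & val p = <[x]>%VS]].

Definition moebius_group (g : proj_point V -> proj_point V) : Prop :=
  projective_transformation g /\ g @` moebius_space = moebius_space.

Definition sphere_of Y : set (proj_point V) :=
  [set p | exists x : V, [/\ x != 0, b x x = 0, x \in Y & val p = <[x]>%VS]].

Definition defines_sphere (k : nat) Y S : Prop :=
  [/\ pseudo_euclidean Y, \dim Y = (k + 2)%N & S = sphere_of Y].

Definition subsphere (k : nat) S : Prop := exists Y, defines_sphere k Y S.

(* The dimension n of the Moebius space is dim V - 2. *)
Definition hypersphere S : Prop := subsphere (\dim {:V} - 2 - 1) S.

Definition general_position (S1 S2 : set (proj_point V)) : Prop :=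
  ~ exists2 Sigma, hypersphere Sigma & S1 `|` S2 `<=` Sigma.

(* The map from the complement of U to the complement of W induced by the
   orthogonal projection of V, i.e. the projection onto the complement of W
   along W (meaningful when V is the direct sum of W and its complement);
   vsproj merely retypes vectors that already lie in the complement of W. *)
Definition perp_proj U W : 'Hom(subvs_of (orthov b U), subvs_of (orthov b W)) :=
  linfun (vsproj (orthov b W) \o daddv_pi (orthov b W) W \o vsval).

Definition pair_operator W U : 'End(subvs_of (orthov b W)) :=
  (perp_proj U W \o perp_proj W U)%VF.

End Forms.

Section Eigenvalues.
Variables (R : realType) (E : vectType R) (A : 'End(E)).

(* The eigenvalues of A in nonincreasing order, counted with (algebraic)
   multiplicity. *)
Definition eigenvalue_list (alpha : seq R) : Prop :=
  sorted >=%R alpha /\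
  char_poly (mxof (vbasis {:E}) (vbasis {:E}) A) =
    \prod_(a <- alpha) ('X - a%:P).

Definition largest_eigenvalue (a : R) : Prop :=
  leigenvalue A a /\ forall c, leigenvalue A c -> c <= a.

End Eigenvalues.

(* Main.v *)
From HB Require Import structures.
Require Import Defs.
From mathcomp Require Import all_boot all_order all_algebra sesquilinear.
From mathcomp Require Import classical_sets reals.
From mathcomp Require Import complex.
From mathcomp Require Import ring lra zify.

(** The norm of a vector x means b(x, x) throughout.  Write E and F for the
    orthogonal complements of W and U.  Both are positive definite, because W and U
    contain negative vectors and the form has index one, and general position says
    that E and F meet in 0 (general_position_orthov).
    The operator A of the pair is e |-> P_E (P_F e), so b(A e, e') is the scalar
    product of the projections of e and e' onto F: A is self-adjoint and has an
    orthonormal eigenbasis (spectral_theorem).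

    Invariance of the eigenvalues: a Moebius transformation is induced by a linear
    map that preserves the null cone, and the null cone determines the form up to a
    factor (null_cone_conformal).  The subspace defining a sphere is spanned by its
    null vectors, so this conformal map carries W and U to the subspaces W' and U'
    of the other pair, hence eigenvectors of A to eigenvectors of A' with the same
    eigenvalues.

    Completeness: for an orthonormal eigenbasis of E, the nonzero vectors P_F e,
    the vectors e - P_F e and an orthonormal basis of the remaining part of F form a
    free orthogonal family whose norms are determined by the eigenvalues.  If two
    pairs have the same eigenvalues, Witt's theorem (witt_extension) gives an
    isometry of V matching the two families, and this isometry maps E to E' and F
    to F' (isometry_of_pairs).  The case of a null vector in the family cannot be
    avoided: it occurs exactly when 1 is an eigenvalue.

    Mutual position: let e be an eigenvector for the largest eigenvalue a.  The
    vector r = e - P_F e is nonzero, orthogonal to the intersection of U and W, and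
    b(r, r) = (1 - a) b(e, e).  If a > 1, then r is negative, so the intersection is
    positive definite, and the hyperspheres orthogonal to e and to P_F e are
    disjoint.  If a = 1, then r is a null vector that lies in the intersection, so
    the intersection is degenerate and [r] is its only point on the Moebius space.
    If a < 1, then E + F is positive definite, so its orthogonal space, which is
    the intersection of U and W, contains a negative vector.  These three
    conclusions exclude one another, which gives the equivalences. *)

Set Implicit Arguments.
Unset Strict Implicit.
Unset Printing Implicit Defensive.

Import Order.TTheory GRing.Theory Num.Theory passmx.

Local Open Scope classical_set_scope.
Local Open Scope ring_scope.

(** * Symmetric bilinear forms and Witt's theorem *)

Section SymmetricForms.
Variables (F : fieldType) (V : vectType F) (b : {symmetric V}).
Implicit Types (x y u v w : V) (X Y Z : {vspace V}) (f g : 'End(V)).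

Lemma formC x y : b x y = b y x.
Proof. by rewrite hermC /= expr0 mul1r. Qed.

Lemma formDl x y u : b (x + y) u = b x u + b y u.
Proof. exact: linearDl. Qed.

Lemma formDr x y u : b u (x + y) = b u x + b u y.
Proof. exact: linearD. Qed.

Lemma formNl x u : b (- x) u = - b x u.
Proof. exact: linearNl. Qed.

Lemma formNr x u : b u (- x) = - b u x.
Proof. exact: linearN. Qed.

Lemma formZl a x u : b (a *: x) u = a * b x u.
Proof. exact: linearZl_LR. Qed.

Lemma formZr a x u : b u (a *: x) = a * b u x.
Proof. exact: linearZ. Qed.

Lemma form0l u : b 0 u = 0.
Proof. exact: linear0l. Qed.

Lemma form0r u : b u 0 = 0.
Proof. exact: linear0. Qed.

Definition formE :=
  (formDl, formDr, formNl, formNr, formZl, formZr, form0l, form0r).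

Lemma orthov_form X x y : x \in orthov b X -> y \in X -> b x y = 0.
Proof. by move=> /mem_orthovP + yX; apply. Qed.

Lemma orthov_cap X Y : orthov b (X + Y) = (orthov b X :&: orthov b Y)%VS.
Proof.
apply/vspaceP => v; rewrite memv_cap.
apply/mem_orthovP/andP => [o|[/mem_orthovP oX /mem_orthovP oY] w].
  split; apply/mem_orthovP => w wX; apply: o.
    exact: (subvP (addvSl _ _)).
  exact: (subvP (addvSr _ _)).
by case/memv_addP => x xX [y yY ->]; rewrite formDr oX // oY // addr0.
Qed.

Lemma mem_orthov_span v (s : seq V) :
  reflect {in s, forall u, b v u = 0} (v \in orthov b <<s>>).
Proof.
apply: (iffP mem_orthovP) => [o u us|o u]; first by apply: o; apply: memv_span.
elim: s u o => [|x s IHs] u o; first by rewrite span_nil memv0 => /eqP->; rewrite form0r.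
rewrite span_cons => /memv_addP[_ /vlineP[a ->] [w ws ->]].
rewrite formDr formZr o ?mem_head // mulr0 add0r; apply: IHs => // t ts.
by apply: o; rewrite in_cons ts orbT.
Qed.

(** Each vector of a basis of Z imposes one linear condition. *)
Lemma dim_cap_orthov_ge X Z : (\dim X <= \dim (X :&: orthov b Z) + \dim Z)%N.
Proof.
have cond (s : seq V) : (\dim X <= \dim (X :&: orthov b <<s>>) + size s)%N.
  elim: s X => [|z s IHs] X /=; first by rewrite span_nil orthov0 capvf addn0.
  rewrite span_cons orthov_cap capvA addnS.
  have := leq_dim_orthov1 b z X; have := IHs (X :&: orthov b <[z]>)%VS.
  lia.
by have := cond (vbasis Z); rewrite size_tuple (span_basis (vbasisP Z)).
Qed.

Definition orthogonal_family (s : seq V) :=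
  {in s &, forall u v, u != v -> b u v = 0}.

Hypothesis b_nondeg : nondegenerate b.

Lemma nondegenerateP x : (forall y, b x y = 0) -> x = 0.
Proof.
move=> o; apply/eqP; rewrite -memv0; move/eqP: b_nondeg => <-.
by apply/mem_orthovP => y _; apply: o.
Qed.

(** One inequality is dim_cap_orthov_ge for the whole space and Y.  The other one is
    the same for Y and a complement Z of the orthogonal space of Y, because a vector
    of Y orthogonal to Z is orthogonal to everything. *)
Lemma dim_orthov Y : (\dim (orthov b Y) + \dim Y = \dim {:V})%N.
Proof.
apply/eqP; rewrite eqn_leq; apply/andP; split; last first.
  by have := dim_cap_orthov_ge fullv Y; rewrite capfv.
set Z := (orthov b Y)^C%VS.
have dZ : (\dim (orthov b Y) + \dim Z = \dim {:V})%N.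
  by rewrite -(addv_complf (orthov b Y)) dimv_disjoint_sum ?capv_compl.
have YZ0 : (Y :&: orthov b Z = 0)%VS.
  apply/eqP; rewrite -subv0; apply/subvP => y; rewrite memv_cap memv0.
  case/andP => yY yZ; apply/eqP/nondegenerateP => w.
  have : w \in (orthov b Y + Z)%VS by rewrite addv_complf memvf.
  case/memv_addP => u uY [z zZ ->].
  by rewrite formDr formC (orthov_form uY yY) (orthov_form yZ zZ) addr0.
have := dim_cap_orthov_ge Y Z; rewrite YZ0 dimv0; lia.
Qed.

Lemma orthovK Y : orthov b (orthov b Y) = Y.
Proof.
apply/esym/eqP; rewrite eqEdim; apply/andP; split.
  apply/subvP => y yY; apply/mem_orthovP => u uY.
  by rewrite formC (orthov_form uY).
have := dim_orthov Y; have := dim_orthov (orthov b Y); lia.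
Qed.

Lemma separating_vector Y x : x \notin Y -> exists2 u, u \in orthov b Y & b x u != 0.
Proof.
by rewrite -{1}(orthovK Y) => /mem_orthovPn[u uY xu]; exists u.
Qed.

Definition isometric f := forall x y, b (f x) (f y) = b x y.

Lemma isometric_inj f : isometric f -> lker f = 0%VS.
Proof.
move=> isof; apply/eqP; rewrite -subv0; apply/subvP => x; rewrite memv_ker memv0.
move=> /eqP fx0; apply/eqP/nondegenerateP => y.
by rewrite -isof fx0 form0l.
Qed.

Lemma isometric_comp f g : isometric f -> isometric g -> isometric (f \o g)%VF.
Proof. by move=> isof isog x y; rewrite !lfunE /= isof isog. Qed.

Definition reflect_fun w x := x - (2 * b x w / b w w) *: w.

Lemma reflect_fun_linear w : linear (reflect_fun w).
Proof.
move=> a x y; rewrite /reflect_fun !formE scalerBr scalerA addrACA -opprD -scalerDl.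
by congr (_ - _ *: _); ring.
Qed.

HB.instance Definition _ w :=
  GRing.isSemilinear.Build F V V _ (reflect_fun w)
    (GRing.semilinear_linear (reflect_fun_linear w)).

Definition reflection w : 'End(V) := linfun (reflect_fun w).

Lemma reflectionE w x : reflection w x = x - (2 * b x w / b w w) *: w.
Proof. by rewrite lfunE. Qed.

Lemma reflection_isometric w : b w w != 0 -> isometric (reflection w).
Proof.
move=> ww x y; rewrite !reflectionE !formE (formC w y); by field.
Qed.

Lemma reflection_fix w x : b x w = 0 -> reflection w x = x.
Proof. by move=> xw; rewrite reflectionE xw mulr0 mul0r scale0r subr0. Qed.

Lemma reflection_swap x y : b x x = b y y -> b (x - y) (x - y) != 0 ->
  reflection (x - y) x = y.
Proof.
move=> xx nz; rewrite reflectionE.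
have -> : 2 * b x (x - y) = b (x - y) (x - y).
  by rewrite !formE (formC y x) -xx; ring.
by rewrite divff // scale1r opprB addrC subrK.
Qed.

Hypothesis two_neq0 : 2 != 0 :> F.

(** Isometries fixing Y act transitively on the vectors orthogonal to Y, outside
    Y, and of a given norm.  If x - y is not null, the reflection in it does the
    job; if it is null but x and y are not, then x + y is not null; and if x, y
    and x - y are all null, a third null vector z, orthogonal to neither x nor y,
    serves as an intermediate stop. *)
Lemma isometry_moving Y x y :
    x \in orthov b Y -> y \in orthov b Y -> x \notin Y -> y \notin Y ->
    b x x = b y y ->
  exists f, [/\ isometric f, {in Y, forall v, f v = v} & f x = y].
Proof.
have refl u v : u \in orthov b Y -> v \in orthov b Y -> b u u = b v v ->
    b (u - v) (u - v) != 0 ->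
    exists f, [/\ isometric f, {in Y, forall v, f v = v} & f u = v].
  move=> uY vY uv nz; exists (reflection (u - v)).
  split; [exact: reflection_isometric| |exact: reflection_swap].
  move=> w wY; apply: reflection_fix.
  by rewrite formC formDl formNl (orthov_form uY wY) (orthov_form vY wY) subrr.
have comp u v w : (exists f, [/\ isometric f, {in Y, forall v, f v = v} & f u = v]) ->
    (exists f, [/\ isometric f, {in Y, forall v, f v = v} & f v = w]) ->
    exists f, [/\ isometric f, {in Y, forall v, f v = v} & f u = w].
  case=> f [isof fixf fu] [g [isog fixg gv]]; exists (g \o f)%VF.
  split; first exact: isometric_comp.
    by move=> t tY; rewrite lfunE /= fixf // fixg.
  by rewrite lfunE /= fu gv.
have four_neq0 : 4 != 0 :> F.
  have -> : 4 = 2 * 2 :> F by ring.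
  by rewrite mulf_neq0.
move=> xY yY xNY yNY xx.
have [nz|] := boolP (b (x - y) (x - y) != 0); first exact: refl.
rewrite negbK => /eqP xy0.
have [yy0|yyN0] := eqVneq (b y y) 0; last first.
  apply: (comp x (- y)).
    apply: refl => //; [by rewrite memvN|by rewrite !formE opprK|].
    rewrite opprK (_ : b _ _ = 4 * b y y) ?mulf_neq0 //.
    transitivity (b (x + y) (x + y) + b (x - y) (x - y)); first by rewrite xy0 addr0.
    rewrite !formE (formC y x) xx; by ring.
  apply: refl; rewrite ?memvN //; first by rewrite !formE opprK.
  rewrite (_ : b _ _ = 4 * b y y); last by rewrite !formE; ring.
  by rewrite mulf_neq0.
have xy : b x y = 0.
  apply/eqP; rewrite -(mulrI_eq0 _ (mulfI two_neq0)) -oppr_eq0; apply/eqP.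
  rewrite -xy0 !formE (formC y x) xx yy0; by ring.
(* a vector of the orthogonal space of Y that is orthogonal to neither x nor y:
   the sum of two separating vectors, unless one of them does already *)
have [u uY [xu yu]] : exists2 u, u \in orthov b Y & b x u != 0 /\ b y u != 0.
  have [u1 u1Y xu1] := separating_vector xNY.
  have [u2 u2Y yu2] := separating_vector yNY.
  have [yu1|] := eqVneq (b y u1) 0; last by exists u1.
  have [xu2|] := eqVneq (b x u2) 0; last by exists u2.
  by exists (u1 + u2); rewrite ?memvD // !formDr yu1 xu2 addr0 add0r.
pose t := - b u u / (2 * b y u); pose z := u + t *: y.
have zY : z \in orthov b Y by rewrite memvD ?memvZ.
have zz : b z z = 0.
  rewrite /z !formE (formC u y) yy0 /t; by field; rewrite yu two_neq0.
have xz : b x z = b x u by rewrite /z !formE xy mulr0 addr0.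
have yz : b y z = b y u by rewrite /z !formE yy0 mulr0 addr0.
clearbody z.
apply: (comp x z); apply: refl => //; rewrite ?xx ?yy0 ?zz //.
- rewrite (_ : b _ _ = - (2 * b x u)) ?oppr_eq0 ?mulf_neq0 //.
  rewrite !formE (formC z x) xx yy0 zz xz; by ring.
- rewrite (_ : b _ _ = - (2 * b y u)) ?oppr_eq0 ?mulf_neq0 //.
  rewrite !formE (formC z y) yy0 zz yz; by ring.
Qed.

(** Witt's extension theorem for orthogonal families, as a list of pairs of
    corresponding vectors; the families may contain null vectors, so the spaces
    that they span may be degenerate.  Once the tails are matched by f, the image
    of the head and its partner are two vectors as in isometry_moving, for Y the
    span of the second tail. *)
Lemma witt_extension (ps : seq (V * V)) :
    free (unzip1 ps) -> free (unzip2 ps) ->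
    orthogonal_family (unzip1 ps) -> orthogonal_family (unzip2 ps) ->
    {in ps, forall p, b p.1 p.1 = b p.2 p.2} ->
  exists2 f, isometric f & {in ps, forall p, f p.1 = p.2}.
Proof.
elim: ps => [|[x y] ps IHps] /=.
  by exists \1%VF => // u v; rewrite !lfunE.
rewrite !free_cons => /andP[xN fx] /andP[yN fy] ox oy nrm.
have tl (z : V) (s : seq V) : orthogonal_family (z :: s) -> orthogonal_family s.
  by move=> o u v us vs; apply: o; rewrite in_cons ?us ?vs orbT.
have hd (z : V) (s : seq V) : orthogonal_family (z :: s) -> z \notin <<s>>%VS ->
    {in s, forall u, b z u = 0}.
  move=> o zN u us; apply: o; rewrite ?mem_head // ?in_cons ?us ?orbT //.
  by apply: contraNneq zN => ->; apply: memv_span.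
have [f isof fps] : exists2 f, isometric f & {in ps, forall p, f p.1 = p.2}.
  apply: IHps => //; [exact: tl ox|exact: tl oy|].
  by move=> p pps; apply: nrm; rewrite in_cons pps orbT.
have imf : (f @: <<unzip1 ps>>)%VS = <<unzip2 ps>>%VS.
  rewrite limg_span /unzip1 /unzip2 -map_comp; congr (<<_>>)%VS.
  by apply/eq_in_map => p /fps.
have [g [isog gfix gfx]] : exists g, [/\ isometric g,
    {in <<unzip2 ps>>%VS, forall v, g v = v} & g (f x) = y].
  apply: isometry_moving => //.
  - apply/mem_orthov_span => _ /mapP[p pps ->]; rewrite -fps // isof.
    by apply: (hd _ _ ox xN); apply: map_f.
  - by apply/mem_orthov_span => u; apply: hd oy yN _.
  - rewrite -imf; apply: contra xN => /memv_imgP[u us fxu].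
    suff -> : x = u by [].
    apply/eqP; rewrite -subr_eq0 -memv0 -(isometric_inj isof) memv_ker.
    by rewrite linearB /= fxu subrr.
  - by rewrite isof; apply: (nrm (x, y)); rewrite mem_head.
exists (g \o f)%VF; first exact: isometric_comp.
move=> p; rewrite in_cons lfunE /= => /predU1P[-> //|pps].
by rewrite fps // gfix // memv_span // map_f.
Qed.

End SymmetricForms.

(** * Spectral theory of self-adjoint endomorphisms *)

Lemma dim_subvs (F : fieldType) (V : vectType F) (X : {vspace V}) :
  \dim {:subvs_of X} = \dim X.
Proof. exact: dimvf. Qed.

Section InvariantPlanes.
Variable R : rcfType.

Lemma complex_eigenvector n (M : 'M[R]_n) : (0 < n)%N ->
  exists s t (x y : 'rV[R]_n), [/\ (x != 0) || (y != 0),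
    x *m M = s *: x - t *: y & y *m M = t *: x + s *: y].
Proof.
move=> n_gt0; pose MC := map_mx (real_complex R) M.
have /closed_rootP[z] : size (char_poly MC) != 1 by rewrite size_char_poly; lia.
rewrite -eigenvalue_root_char => /eigenvalueP[v vM v0].
have ReD : {morph @complex.Re R : a c / a + c} by move=> [? ?] [? ?].
have ImD : {morph @complex.Im R : a c / a + c} by move=> [? ?] [? ?].
exists (complex.Re z), (complex.Im z).
exists (\row_j complex.Re (v 0 j)), (\row_j complex.Im (v 0 j)).
have vMj j : \sum_i v 0 i * (M i j)%:C%C = z * v 0 j.
  have /matrixP/(_ 0 j) := vM; rewrite !mxE => <-.
  by apply: eq_bigr => i _; rewrite !mxE.
split.
- apply: contraNT v0; rewrite negb_or !negbK => /andP[/eqP/rowP x0 /eqP/rowP y0].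
  apply/eqP/rowP => j; have := x0 j; have := y0 j; rewrite !mxE.
  by case: (v 0 j) => a c /= -> ->.
- apply/rowP => j; have := congr1 (@complex.Re R) (vMj j).
  rewrite !mxE (big_morph _ ReD (erefl _)).
  case: z (v 0 j) {vM vMj} => [s t] [x y] /= <-.
  by apply: eq_bigr => i _; rewrite !mxE; case: (v 0 i) => ? ? /=; ring.
- apply/rowP => j; have := congr1 (@complex.Im R) (vMj j).
  rewrite !mxE (big_morph _ ImD (erefl _)).
  case: z (v 0 j) {vM vMj} => [s t] [x y] /=; rewrite addrC [_ * y + _]addrC => <-.
  by apply: eq_bigr => i _; rewrite !mxE; case: (v 0 i) => ? ? /=; ring.
Qed.

(** The vectors x and y are the real and imaginary parts of a complex eigenvector
    of the restriction of A to X, for the eigenvalue s + it. *)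
Lemma invariant_plane (V : vectType R) (A : 'End(V)) (X : {vspace V}) :
    (A @: X <= X)%VS -> X != 0%VS ->
  exists s t x y, [/\ x \in X, y \in X, (x != 0) || (y != 0),
    A x = s *: x - t *: y & A y = t *: x + s *: y].
Proof.
move=> AX X0; pose B : 'End(subvs_of X) := linfun (vsproj X \o A \o vsval).
have BE u : vsval (B u) = A (vsval u).
  by rewrite lfunE /= vsprojK // (subvP AX) // memv_img // subvsP.
have e_basis := vbasisP {:subvs_of X}; set e := vbasis _ in e_basis.
have [|s [t [x [y [xy0 xB yB]]]]] := complex_eigenvector (mxof e e B).
  by rewrite lt0n dim_subvs dimv_eq0.
exists s, t, (vsval (vecof e x)), (vsval (vecof e y)).
have nz u : (vsval (vecof e u) != 0) = (u != 0).
  by rewrite -(vecof_eq0 e_basis u) -(inj_eq val_inj).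
rewrite !nz !subvsP -!BE !(hom_vecof _ e_basis) // xB yB.
have vecD a c (u w : 'rV_(\dim {:subvs_of X})) :
    vsval (vecof e (a *: u + c *: w)) = a *: vsval (vecof e u) + c *: vsval (vecof e w).
  have comb (U W : lmodType R) (f : {linear U -> W}) p q :
      f (a *: p + c *: q) = a *: f p + c *: f q.
    by rewrite linearP linearZ_LR.
  by rewrite -(comb _ _ (@vsval _ _ X)) -(comb _ _ (vecof e)).
by split=> //; rewrite -?scaleNr vecD.
Qed.

End InvariantPlanes.

Section Spectral.
Variables (R : realType) (V : vectType R) (b : {symmetric V}).
Implicit Types (A : 'End(V)) (X : {vspace V}).

Lemma euclideanS X Y : (X <= Y)%VS -> euclidean b Y -> euclidean b X.
Proof. by move=> XY pos x xX; apply: pos; apply: (subvP XY). Qed.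

Lemma euclidean_eq0 X x : euclidean b X -> x \in X -> b x x = 0 -> x = 0.
Proof.
by move=> pos xX xx; apply/eqP; apply: contraT => /(pos x xX); rewrite xx ltxx.
Qed.

Lemma euclidean_ge0 X x : euclidean b X -> x \in X -> 0 <= b x x.
Proof.
move=> pos xX; have [->|/(pos x xX)/ltW//] := eqVneq x 0.
by rewrite form0l.
Qed.

Definition orthonormal_basis X (es : seq V) :=
  [/\ basis_of X es, orthogonal_family b es & {in es, forall e, b e e = 1}].

Definition self_adjoint_on A X := {in X &, forall x y, b (A x) y = b x (A y)}.

(** On the invariant plane of x and y, self-adjointness equates
    s b(x,y) - t b(y,y) with s b(x,y) + t b(x,x), so the imaginary part t
    vanishes. *)
Lemma self_adjoint_eigenvector A X :
    euclidean b X -> (A @: X <= X)%VS -> self_adjoint_on A X -> X != 0%VS ->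
  exists s x, [/\ x \in X, x != 0 & A x = s *: x].
Proof.
move=> pos AX sa X0.
have [s [t [x [y [xX yX xy0 Ax Ay]]]]] := invariant_plane AX X0.
have := sa x y xX yX; rewrite Ax Ay !formE => eqt.
have xx := euclidean_ge0 pos xX; have yy := euclidean_ge0 pos yX.
have sum_gt0 : 0 < b x x + b y y.
  by case/orP: xy0 => [/(pos x xX)|/(pos y yX)] ?; lra.
have t0 : t = 0.
  have /eqP : t * (b x x + b y y) = 0 by lra.
  by rewrite mulf_eq0 (gt_eqF sum_gt0) orbF => /eqP.
rewrite t0 !scale0r subr0 add0r in Ax Ay.
by case/orP: xy0 => ?; [exists s, x|exists s, y].
Qed.

(** The orthogonal space of an eigenvector is stable under A, hence an induction on
    the dimension of X.  The eigenvalue of a unit eigenvector e is b(Ae, e); naming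
    it so spares a separate list of eigenvalues. *)
Lemma spectral_theorem A X :
    euclidean b X -> (A @: X <= X)%VS -> self_adjoint_on A X ->
  exists es : seq V, orthonormal_basis X es /\
    {in es, forall e, A e = b (A e) e *: e}.
Proof.
have [d] := ubnP (\dim X); elim: d X => // d IHd X dX pos AX sa.
have [->|X0] := eqVneq X 0%VS; first by exists [::]; do !split; rewrite ?nil_basis // => ? .
have [s [x [xX x0 Ax]]] := self_adjoint_eigenvector pos AX sa X0.
have xx := pos x xX x0.
pose e := (Num.sqrt (b x x))^-1 *: x.
have eX : e \in X by rewrite memvZ.
have Ae : A e = s *: e by rewrite linearZ /= Ax !scalerA mulrC.
have ee : b e e = 1.
  rewrite !formE mulrA -invfM -expr2 sqr_sqrtr ?ltW // mulVf //.
  by rewrite gt_eqF.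
clearbody e.
pose Y := (X :&: orthov b <[e]>)%VS.
have YX : (Y <= X)%VS by apply: capvSl.
have eNY : e \notin Y by rewrite memv_cap mem_orthov1 ee oner_eq0 andbF.
have e0 : e != 0 by apply: contraNneq eNY => ->; rewrite mem0v.
have XE : (<[e]> + Y)%VS = X.
  apply/eqP; rewrite eqEsubv; apply/andP; split.
    by rewrite subv_add YX -memvE eX.
  apply/subvP => u uX; rewrite -[u](subrK (b u e *: e)) addrC memv_add //.
    by rewrite memvZ // memv_line.
  by rewrite memv_cap mem_orthov1 rpredB ?memvZ // !formE ee mulr1 subrr /=.
have cap0 : (<[e]> :&: Y)%VS = 0%VS.
  apply/eqP; rewrite -subv0; apply/subvP => u; rewrite memv_cap.
  case/andP => /vlineP[a ->] aY; rewrite memv0 scaler_eq0.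
  have [//|a0] := eqVneq a 0; case/negP: eNY.
  by rewrite -[e](scalerK a0) memvZ.
have [| | | |es [[es_basis es_o es_1] es_eig]] := IHd Y.
- suff : (\dim X = 1 + \dim Y)%N by lia.
  by rewrite -XE dimv_disjoint_sum // dim_vline e0.
- exact: euclideanS pos.
- apply/subvP => _ /memv_imgP[u uY ->]; move: uY.
  rewrite !memv_cap !mem_orthov1 => /andP[uX /eqP ue].
  by rewrite (subvP AX) ?memv_img // (sa u e) // Ae formE ue mulr0 eqxx.
- by move=> u v uY vY; apply: sa; apply: (subvP YX).
exists (e :: es); have esY := basis_mem es_basis.
have oe : {in es, forall v, b e v = 0}.
  by move=> v /esY; rewrite memv_cap mem_orthov1 formC => /andP[_ /eqP].
split; first split.
- rewrite basisEfree free_cons (span_basis es_basis) eNY (basis_free es_basis).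
  rewrite span_cons (span_basis es_basis) XE subvv /=.
  rewrite -XE dimv_disjoint_sum // dim_vline e0.
  by rewrite -(span_basis es_basis) (eqP (basis_free es_basis)).
- move=> u v; rewrite !in_cons.
  case/predU1P=> [->|ues] /predU1P[->|ves]; rewrite ?eqxx //.
  + by move=> _; apply: oe.
  + by move=> _; rewrite formC; apply: oe.
  + exact: es_o.
- by move=> u; rewrite in_cons => /predU1P[-> //|/es_1].
move=> u; rewrite in_cons => /predU1P[->|/es_eig//].
by rewrite Ae formE ee mulr1.
Qed.

Lemma orthonormal_basis_exists X : euclidean b X -> exists es, orthonormal_basis X es.
Proof.
move=> pos; have [||es [es_on _]] := @spectral_theorem \1%VF X pos.
- by rewrite lim1g.
- by move=> x y _ _; rewrite !lfunE.
- by exists es.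
Qed.

End Spectral.

Section CharacteristicPolynomial.
Variable F : fieldType.

Lemma char_poly_similar n (M N P Q : 'M[F]_n) :
  P *m Q = 1%:M -> P *m N = M *m P -> char_poly M = char_poly N.
Proof.
move=> PQ PN; rewrite /char_poly.
pose PX := map_mx (@polyC F) P; pose QX := map_mx (@polyC F) Q.
have PQX : PX *m QX = 1%:M by rewrite -map_mxM PQ map_mx1.
have -> : char_poly_mx M = PX *m char_poly_mx N *m QX.
  rewrite /char_poly_mx mulmxBr mulmxBl -[PX *m map_mx _ N]map_mxM PN map_mxM.
  rewrite -[_ *m PX *m QX]mulmxA PQX mulmx1.
  by rewrite mul_mx_scalar -scalemxAl PQX scalemx1.
by rewrite !det_mulmx mulrAC -det_mulmx PQX det1 mul1r.
Qed.

Lemma char_poly_eigenbasis (T : vectType F) (A : 'End(T)) (es : seq T) (lam : T -> F) :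
    basis_of {:T} es -> {in es, forall e, A e = lam e *: e} ->
  char_poly (mxof (vbasis {:T}) (vbasis {:T}) A) =
    \prod_(a <- map lam es) ('X - a%:P).
Proof.
move=> es_basis es_eig.
have sz : size es = \dim {:T} by rewrite -(span_basis es_basis) (eqP (basis_free es_basis)).
pose t : (\dim {:T}).-tuple T := tcast sz (in_tuple es).
have tE : t = es :> seq T by rewrite val_tcast.
have t_basis : basis_of {:T} t by rewrite tE.
have v_basis := vbasisP {:T}; set v := vbasis _ in v_basis *.
(* the matrix of A in the basis es itself is diagonal *)
rewrite (char_poly_similar (P := mxof v t \1) (Q := mxof t v \1) (N := mxof t t A)).
- rewrite char_poly_trig; last first.
    apply/is_trig_mxP => i j ij; rewrite !mxE /= vecof_delta.
    rewrite es_eig -?tE ?mem_nth ?size_tuple // linearZ /= coord_free ?(basis_free t_basis) //.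
    have /negbTE-> : (i != j) by rewrite -val_eqE neq_ltn ij.
    by rewrite mulr0.
  rewrite big_map -[X in _ = \prod_(e <- X) _]tE (big_nth 0) size_tuple.
  rewrite big_mkord; apply: eq_bigr => i _.
  rewrite !mxE /= vecof_delta.
  rewrite es_eig -?tE ?mem_nth ?size_tuple // linearZ /= coord_free ?(basis_free t_basis) //.
  by rewrite eqxx mulr1.
- by rewrite -mxof_comp // comp_lfun1l mxof1 ?(basis_free v_basis).
- by rewrite -!mxof_comp // comp_lfun1l comp_lfun1r.
Qed.

End CharacteristicPolynomial.

(** * Forms of index one *)

Section Lorentz.
Variables (R : realType) (V : vectType R) (b : {symmetric V}).
Hypothesis b_nondeg : nondegenerate b.
Hypothesis b_index1 : has_index b fullv 1.
Implicit Types (x y u v w : V) (X Y Z : {vspace V}).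

Lemma index_one_negative Y : has_index b Y 1 -> exists2 v, v \in Y & b v v < 0.
Proof.
case=> -[N [NY Nneg dN]] _; exists (vpick N); first exact: (subvP NY _ (memv_pick _)).
by apply: Nneg; rewrite ?memv_pick // vpick0 -dimv_eq0 dN.
Qed.

(** If x were negative, v and x would span a negative definite plane. *)
Lemma orthogonal_negative_ge0 v x : b v v < 0 -> b x v = 0 -> 0 <= b x x.
Proof.
move=> vv xv; rewrite leNgt; apply/negP => xx.
have xNv : x \notin <[v]>%VS.
  by apply/negP => /vlineP[a xE]; move: xv xx vv; rewrite xE !formE; nra.
have v0 : v != 0 by apply: contraTneq vv => ->; rewrite form0l ltxx.
have [_ /(_ (<[v]> + <[x]>)%VS)] := b_index1; rewrite subvf => /(_ isT) dimle.
have : (\dim (<[v]> + <[x]>) <= 1)%N.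
  apply: dimle => _ /memv_addP[_ /vlineP[a ->] [_ /vlineP[c ->] ->]] nz.
  rewrite !formE (formC b v x) xv.
  have [a0|a0] := eqVneq a 0.
    have c0 : c != 0 by apply: contraNneq nz => ->; rewrite a0 !scale0r addr0.
    rewrite a0; have : 0 < c ^+ 2 by rewrite lt0r sqr_ge0 sqrf_eq0 c0.
    by nra.
  have : 0 < a ^+ 2 by rewrite lt0r sqr_ge0 sqrf_eq0 a0.
  by have := sqr_ge0 c; nra.
rewrite dimv_disjoint_sum ?dim_vline ?v0.
  have -> : x != 0 by apply: contraNneq xNv => ->; rewrite mem0v.
  by [].
apply/eqP; rewrite -subv0; apply/subvP => u; rewrite memv_cap memv0.
case/andP => /vlineP[a ->] /vlineP[c ac].
have [c0|c0] := eqVneq c 0; first by rewrite ac c0 scale0r.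
by case/negP: xNv; rewrite -[x](scalerK c0) -ac !memvZ ?memv_line.
Qed.

(** If x were a null vector orthogonal to v, then y + t x, for a vector y
    orthogonal to v but not to x, would be negative for some t. *)
Lemma orthogonal_negative_gt0 v x : b v v < 0 -> b x v = 0 -> x != 0 -> 0 < b x x.
Proof.
move=> vv xv x0; rewrite lt0r (orthogonal_negative_ge0 vv xv) andbT; apply/eqP => xx.
have [u _ xu] : exists2 u, u \in fullv & b x u != 0.
  have [|u _ xu] := separating_vector b_nondeg (Y := 0) (x := x); first by rewrite memv0.
  by exists u; rewrite ?memvf.
pose y := u - (b u v / b v v) *: v.
have yv : b y v = 0 by rewrite /y !formE; field; rewrite lt_eqF.
have xy : b x y = b x u by rewrite /y !formE xv mulr0 subr0.
clearbody y; pose t := - (b y y + 1) / (2 * b x y); pose z := y + t *: x.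
have zv : b z v = 0 by rewrite /z !formE xv yv mulr0 addr0.
have := orthogonal_negative_ge0 vv zv.
suff -> : b z z = -1 by lra.
rewrite /z !formE (formC b y x) xx /t; field.
by move: xu; rewrite -xy.
Qed.

Lemma orthov_negative_euclidean v Y : v \in Y -> b v v < 0 -> euclidean b (orthov b Y).
Proof.
move=> vY vv x xY; apply: (orthogonal_negative_gt0 vv).
exact: orthov_form xY vY.
Qed.

Lemma pseudo_euclideanP Y : pseudo_euclidean b Y <-> exists2 v, v \in Y & b v v < 0.
Proof.
split=> [[_ /index_one_negative//]|[v vY vv]]; split.
  apply/eqP; rewrite -subv0; apply/subvP => x; rewrite memv_cap memv0.
  case/andP=> xY xo; apply: contraT => /(orthov_negative_euclidean vY vv xo).
  by rewrite (orthov_form xo xY) ltxx.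
split; last by move=> N _; apply: b_index1.2; apply: subvf.
exists <[v]>%VS; split; first by rewrite -memvE.
  move=> _ /vlineP[a ->]; rewrite scaler_eq0 negb_or => /andP[a0 _].
  rewrite !formE mulrA pmulr_rlt0 // -expr2 lt0r sqr_ge0 sqrf_eq0 a0 //.
by rewrite dim_vline; case: eqP vv => // ->; rewrite form0l ltxx.
Qed.

(** Subtract from y the multiple of x that makes the difference orthogonal to a
    negative vector e: the difference is null and lies in the positive definite
    orthogonal space of e. *)
Lemma orthogonal_null_proportional x y :
  x != 0 -> b x x = 0 -> b y y = 0 -> b x y = 0 -> y \in <[x]>%VS.
Proof.
move=> x0 xx yy xy; have [e _ ee] := index_one_negative b_index1.
have xe : b x e != 0.
  by apply: contra_eq_neq xx => /(orthogonal_negative_gt0 ee) /(_ x0)/gt_eqF ->.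
pose z := y - (b y e / b x e) *: x.
have zz : b z z = 0 by rewrite /z !formE (formC b y x) xx yy xy; ring.
have ze : b z e = 0 by rewrite /z !formE; field.
have : z = 0.
  apply/eqP; apply: contraT => z0.
  by have := orthogonal_negative_gt0 ee ze z0; rewrite zz ltxx.
by move/eqP; rewrite subr_eq0 => /eqP->; rewrite memvZ // memv_line.
Qed.

(** The factor s rescales u so that its norm becomes opposite to that of e. *)
Lemma null_combinations e u : b e e < 0 -> b u e = 0 -> u != 0 ->
  exists s, [/\ s != 0, s * s = - b e e / b u u &
    forall t, t * t = s * s -> b (e + t *: u) (e + t *: u) = 0].
Proof.
move=> ee ue u0; have uu := orthogonal_negative_gt0 ee ue u0.
pose s := Num.sqrt (- b e e / b u u).
have ss : s * s = - b e e / b u u.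
  by rewrite -expr2 sqr_sqrtr // divr_ge0 ?ltW // oppr_gt0.
exists s; split=> // [|t tt].
  apply/eqP => s0; move: ss; rewrite s0 mulr0 => /esym/eqP.
  by rewrite mulf_eq0 invr_eq0 oppr_eq0 (lt_eqF ee) (gt_eqF uu).
rewrite !formE (formC b e u) ue !mulr0 addr0 add0r mulrA tt ss.
by field; rewrite gt_eqF.
Qed.

(** Let v be a negative vector of Y.  A vector u of Y orthogonal to v gives two
    null vectors v + s u and v - s u, which span the same plane as v and u. *)
Lemma null_vectors_span Y Z :
    pseudo_euclidean b Y -> (1 < \dim Y)%N ->
    {in Y, forall x, b x x = 0 -> x \in Z} ->
  (Y <= Z)%VS.
Proof.
move=> /pseudo_euclideanP[v vY vv] dimY YZ.
have pm u : u \in Y -> b u v = 0 -> u != 0 -> v \in Z /\ u \in Z.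
  move=> uY uv u0; have [s [s0 _ null]] := null_combinations vv uv u0.
  have nullZ t : t * t = s * s -> v + t *: u \in Z.
    by move=> tt; apply: YZ; [rewrite memvD ?memvZ|exact: null].
  have p := nullZ s erefl; have m := nullZ (- s) (mulrNN s s).
  have vZ : v \in Z.
    suff -> : v = 2^-1 *: ((v + s *: u) + (v + - s *: u)) by rewrite memvZ // memvD.
    rewrite scaleNr addrACA subrr addr0 -mulr2n -scaler_nat scalerA.
    by rewrite mulVf ?scale1r ?pnatr_eq0.
  split=> //; rewrite -[u](scalerK s0) memvZ //.
  by rewrite -[s *: u](addKr v) memvD // memvN.
have [u0 [u0Y u0v u00]] : exists u, [/\ u \in Y, b u v = 0 & u != 0].
  pose N := (Y :&: orthov b <[v]>)%VS; have N0 : vpick N != 0.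
    rewrite vpick0 -dimv_eq0; have := leq_dim_orthov1 b v Y; rewrite -/N; lia.
  have := memv_pick N; rewrite memv_cap mem_orthov1 => /andP[NY /eqP Nv].
  by exists (vpick N).
have [vZ _] := pm _ u0Y u0v u00.
apply/subvP => y yY; pose u := y - (b y v / b v v) *: v.
have uY : u \in Y by rewrite memvB ?memvZ.
have uv : b u v = 0 by rewrite /u !formE; field; rewrite lt_eqF.
rewrite -[y](subrK ((b y v / b v v) *: v)) memvD ?memvZ // -/u.
have [->|/(pm _ uY uv)[]//] := eqVneq u 0; exact: mem0v.
Qed.

Fact dim_line x : x != 0 -> \dim <[x]> == 1%N.
Proof. by rewrite dim_vline => ->. Qed.

Definition point_of x (x0 : x != 0) : proj_point V := exist _ <[x]>%VS (dim_line x0).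

Lemma sphere_of_point Y x (x0 : x != 0) :
  b x x = 0 -> x \in Y -> sphere_of b Y (point_of x0).
Proof. by move=> xx xY; exists x. Qed.

Lemma sphere_of_pointP Y x (x0 : x != 0) : sphere_of b Y (point_of x0) -> x \in Y.
Proof. by case=> y [_ _ yY /= xy]; rewrite memvE xy -memvE. Qed.

Lemma sphere_ofS Y Z : (Y <= Z)%VS -> sphere_of b Y `<=` sphere_of b Z.
Proof. by move=> YZ p [x [x0 xx xY px]]; exists x; split=> //; apply: (subvP YZ). Qed.

(** A sphere determines its subspace, which is spanned by its null vectors. *)
Lemma sphere_of_sub Y Z : pseudo_euclidean b Y -> (1 < \dim Y)%N ->
  sphere_of b Y `<=` sphere_of b Z -> (Y <= Z)%VS.
Proof.
move=> Yp dY YZ; apply: null_vectors_span => // x xY xx.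
have [->|x0] := eqVneq x 0; first exact: mem0v.
exact/(sphere_of_pointP (x0 := x0))/YZ/sphere_of_point.
Qed.

Lemma sphere_of_cap Y Z : sphere_of b Y `&` sphere_of b Z = sphere_of b (Z :&: Y)%VS.
Proof.
apply/seteqP; split=> p.
  move=> [[x [x0 xx xY px]] [y [_ _ yZ py]]]; exists x; split=> //.
  by rewrite memv_cap xY andbT memvE -px py -memvE.
by move=> [x [x0 xx]]; rewrite memv_cap => /andP[xZ xY] px; split; exists x.
Qed.

Lemma sphere_of_euclidean Y : euclidean b Y -> sphere_of b Y = set0.
Proof.
move=> Ypos; apply/seteqP; split=> // p [x [x0 xx xY _]].
by have := Ypos x xY x0; rewrite xx ltxx.
Qed.

Hypothesis dimV3 : (2 < \dim {:V})%N.

(** A negative vector stays negative when its component along u is removed. *)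
Lemma hypersphere_orthov u : 0 < b u u -> hypersphere b (sphere_of b (orthov b <[u]>)).
Proof.
move=> uu; exists (orthov b <[u]>)%VS; split=> //.
  apply/pseudo_euclideanP; have [e _ ee] := index_one_negative b_index1.
  exists (e - (b e u / b u u) *: u).
    by rewrite mem_orthov1 !formE; apply/eqP; field; rewrite gt_eqF.
  have -> : b (e - (b e u / b u u) *: u) (e - (b e u / b u u) *: u)
      = b e e - b e u ^+ 2 / b u u.
    by rewrite !formE (formC b u e); field; rewrite gt_eqF.
  have : 0 <= b e u ^+ 2 / b u u by rewrite divr_ge0 ?sqr_ge0 // ltW.
  by lra.
have := dim_orthov b_nondeg <[u]>; rewrite dim_vline.
have -> : u != 0 by apply: contraTneq uu => ->; rewrite form0l ltxx.
lia.
Qed.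

(** A nonzero vector u orthogonal to both W and U is positive, because W contains a
    negative vector; the orthogonal space of u then defines a hypersphere through
    both spheres. *)
Lemma general_position_orthov W U : pseudo_euclidean b W ->
    general_position b (sphere_of b W) (sphere_of b U) ->
  (orthov b W :&: orthov b U = 0)%VS.
Proof.
move=> /pseudo_euclideanP[w wW ww] gp; apply/eqP; rewrite -subv0; apply/subvP => u.
rewrite memv_cap memv0 => /andP[uW uU]; apply: contraT => u0; case: gp.
exists (sphere_of b (orthov b <[u]>)).
  by apply: hypersphere_orthov; apply: (orthov_negative_euclidean wW ww).
by move=> p [|]; apply: sphere_ofS; rewrite -mem_orthov_sym.
Qed.

End Lorentz.

(** * The operator of a pair of subspaces *)

Section PairOperator.
Variables (R : realType) (V : vectType R) (b : {symmetric V}).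
Hypothesis b_nondeg : nondegenerate b.
Implicit Types (x y e : V) (W U : {vspace V}).

Definition perp W : 'End(V) := daddv_pi (orthov b W) W.

Lemma perp_mem W x : perp W x \in orthov b W.
Proof. exact: memv_pi. Qed.

Section Projection.
Variable W : {vspace V}.
Hypothesis W_nondeg : nondegenerate_on b W.

Lemma orthov_cap0 : (orthov b W :&: W = 0)%VS.
Proof. by rewrite capvC. Qed.

Lemma orthov_add : (orthov b W + W = fullv)%VS.
Proof.
apply/eqP; rewrite eqEdim subvf dimv_disjoint_sum ?orthov_cap0 //.
by rewrite (dim_orthov b_nondeg) leqnn.
Qed.

Lemma perp_compl x : x - perp W x \in W.
Proof.
have := daddv_pi_add orthov_cap0 (w := x); rewrite orthov_add memvf => /(_ isT) xE.
by rewrite -[X in X - _]xE addrC addKr memv_pi.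
Qed.

Lemma perp_unique x e : e \in orthov b W -> x - e \in W -> perp W x = e.
Proof.
move=> eW xeW; apply/eqP; rewrite -subr_eq0 -memv0 -orthov_cap0 memv_cap.
rewrite memvB ?perp_mem //=.
have -> : perp W x - e = (x - e) - (x - perp W x) by rewrite opprB [RHS]addrC subrKA.
by rewrite memvB // perp_compl.
Qed.

Lemma form_perpl x e : e \in orthov b W -> b (perp W x) e = b x e.
Proof.
move=> eW; apply/eqP; rewrite -subr_eq0 -opprB oppr_eq0 -formNl -formDl formC.
by rewrite (orthov_form eW) // perp_compl.
Qed.

End Projection.

(** The operator of the pair as an endomorphism of V, which it maps to the complement
    of W; it spares the passage through the type of vectors of that complement. *)
Definition perp2 W U : 'End(V) := (perp W \o perp U)%VF.

Variables (W U : {vspace V}).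
Hypotheses (W_nondeg : nondegenerate_on b W) (U_nondeg : nondegenerate_on b U).
Hypothesis W_pos : euclidean b (orthov b W).

(** Hence the operator is self-adjoint, and b(Ae, e) is the norm of the projection
    of e onto the complement of U. *)
Lemma form_perp2 x e : e \in orthov b W -> b (perp2 W U x) e = b (perp U x) (perp U e).
Proof.
move=> eW; rewrite lfunE /= form_perpl // formC (formC b (perp U x)).
by rewrite form_perpl ?perp_mem.
Qed.

Lemma perp2_mem x : perp2 W U x \in orthov b W.
Proof. by rewrite lfunE perp_mem. Qed.

Lemma pair_operatorE u : vsval (pair_operator b W U u) = perp2 W U (vsval u).
Proof.
have val Y Z v : vsval (perp_proj b Y Z v) = perp Z (vsval v).
  by rewrite lfunE /= vsprojK ?perp_mem.
by rewrite !lfunE /= !val.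
Qed.

Lemma leigenvalueP a : reflect
  (exists e, [/\ e \in orthov b W, e != 0 & perp2 W U e = a *: e])
  (leigenvalue (pair_operator b W U) a).
Proof.
rewrite /leigenvalue; apply: (iffP idP) => [|[e [eW e0 eig]]].
  rewrite -vpick0 => nz; have := memv_pick (leigenspace (pair_operator b W U) a).
  set u := vpick _ in nz *; rewrite memv_ker !lfunE /= opp_lfunE scale_lfunE id_lfunE.
  rewrite subr_eq0 => /eqP eig; exists (vsval u); split; first exact: subvsP.
    by apply: contra nz => /eqP u0; apply/eqP/val_inj.
  by rewrite -pair_operatorE eig.
apply: contraNneq e0 => eigs0.
have : vsproj (orthov b W) e \in leigenspace (pair_operator b W U) a.
  rewrite memv_ker !lfunE /= opp_lfunE scale_lfunE id_lfunE subr_eq0; apply/eqP/val_inj.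
  by rewrite /= pair_operatorE vsprojK // eig.
by rewrite eigs0 memv0 => /eqP/(congr1 vsval); rewrite vsprojK // => ->.
Qed.

Lemma perp2_spectral : exists es, orthonormal_basis b (orthov b W) es /\
  {in es, forall e, perp2 W U e = b (perp2 W U e) e *: e}.
Proof.
apply: spectral_theorem => //.
  by apply/subvP => _ /memv_imgP[x _ ->]; apply: perp2_mem.
by move=> x y xW yW; rewrite form_perp2 // formC (formC b x) form_perp2.
Qed.

Lemma char_poly_pair_operator (es : seq V) (lam : V -> R) :
    basis_of (orthov b W) es -> {in es, forall e, perp2 W U e = lam e *: e} ->
  let v := vbasis {:subvs_of (orthov b W)} in
  char_poly (mxof v v (pair_operator b W U)) =
    \prod_(a <- map lam es) ('X - a%:P).
Proof.
move=> es_basis es_eig v.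
have esW := basis_mem es_basis.
pose p : 'Hom(V, subvs_of (orthov b W)) := linfun (vsproj (orthov b W)).
have pK e : e \in es -> vsval (vsproj (orthov b W) e) = e.
  by move=> /esW; apply: vsprojK.
rewrite (char_poly_eigenbasis (es := map (vsproj (orthov b W)) es)
    (lam := lam \o vsval)).
- rewrite -map_comp; congr (\prod_(a <- _) _); apply/eq_in_map => e ee /=.
  by rewrite pK.
- have -> : map (vsproj (orthov b W)) es = map p es.
    by apply: eq_map => e; rewrite lfunE.
  have -> : fullv = (p @: orthov b W)%VS.
    apply/eqP; rewrite eqEsubv subvf andbT; apply/subvP => u _.
    by rewrite -[u]vsvalK -[vsproj _ _](lfunE (vsproj (orthov b W))) memv_img ?subvsP.
  apply: limg_basis_of => //; apply/eqP; rewrite -subv0; apply/subvP => e.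
  rewrite memv_cap memv_ker lfunE /= => /andP[eW /eqP/(congr1 vsval)].
  by rewrite vsprojK // => ->; apply: mem0v.
- move=> _ /mapP[e ee ->]; apply: val_inj.
  by rewrite /= pair_operatorE pK // es_eig.
Qed.

(** The basis is an orthonormal eigenbasis sorted by eigenvalue: both its list of
    eigenvalues and alpha are sorted lists of the roots of one polynomial. *)
Lemma eigenvalue_listP (alpha : seq R) :
    eigenvalue_list (pair_operator b W U) alpha ->
  exists es, [/\ orthonormal_basis b (orthov b W) es,
    {in es, forall e, perp2 W U e = b (perp2 W U e) e *: e} &
    map (fun e => b (perp2 W U e) e) es = alpha].
Proof.
move=> [alpha_sorted alphaE]; have [es [[es_basis es_o es_1] es_eig]] := perp2_spectral.
pose lam e := b (perp2 W U e) e.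
pose es' := sort (relpre lam >=%R) es.
have pe : perm_eq es' es by rewrite perm_sort.
have mem_es' : es' =i es by apply: perm_mem.
exists es'; split.
- split.
  + by rewrite (perm_basis _ pe).
  + by move=> u v; rewrite !mem_es'; apply: es_o.
  + by move=> u; rewrite mem_es'; apply: es_1.
- by move=> e; rewrite mem_es'; apply: es_eig.
- rewrite -[map _ _](sort_map (f := lam)).
  have ge_tr : transitive (>=%R : rel R) by move=> x y z xy yz; apply: le_trans yz xy.
  apply: (sorted_eq ge_tr) => //.
  + by move=> x y; rewrite andbC => /le_anti.
  + by apply: sort_sorted => x y; apply: le_total.
  rewrite perm_sort; apply: prod_XsubC_eq.
  by rewrite -(char_poly_pair_operator es_basis es_eig) alphaE.
Qed.

End PairOperator.

(** * Moebius transformations and conformal maps *)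

Section Conformal.
Variables (R : realType) (V : vectType R) (b : {symmetric V}).
Hypothesis b_nondeg : nondegenerate b.
Implicit Types (x y u v : V) (Y W U : {vspace V}) (f : 'End(V)).
Implicit Types (g : proj_point V -> proj_point V).

Definition conformal f c := forall x y, b (f x) (f y) = c * b x y.

Lemma isometric_conformal f : isometric b f -> conformal f 1.
Proof. by move=> isof x y; rewrite mul1r isof. Qed.

Lemma conformal_orthov f c Y : lker f = 0%VS -> c != 0 -> conformal f c ->
  (f @: orthov b Y)%VS = orthov b (f @: Y).
Proof.
move=> f0 c0 cf; apply/eqP; rewrite eqEdim; apply/andP; split.
  apply/subvP => _ /memv_imgP[x xY ->]; apply/mem_orthovP => _ /memv_imgP[y yY ->].
  by rewrite cf (orthov_form xY yY) mulr0.
have dimf Z : \dim (f @: Z) = \dim Z by rewrite limg_dim_eq // f0 capv0.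
rewrite dimf; have := dim_orthov b_nondeg Y.
have := dim_orthov b_nondeg (f @: Y)%VS; rewrite dimf; lia.
Qed.

Lemma conformal_perp f c W x : lker f = 0%VS -> c != 0 -> conformal f c ->
    nondegenerate_on b W -> nondegenerate_on b (f @: W) ->
  perp b (f @: W) (f x) = f (perp b W x).
Proof.
move=> f0 c0 cf Wn fWn; apply: perp_unique => //.
  by rewrite -(conformal_orthov _ f0 c0 cf) memv_img // perp_mem.
by rewrite -linearB memv_img // perp_compl.
Qed.

Definition induces f g := forall p, val (g p) = (f @: val p)%VS.

Lemma image_sphere_of f g c Y : lker f = 0%VS -> c != 0 -> conformal f c ->
  induces f g -> g @` sphere_of b Y = sphere_of b (f @: Y).
Proof.
move=> f0 c0 cf fg; have nz x : x != 0 -> f x != 0.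
  by move=> x0; rewrite -memv_ker f0 memv0.
apply/seteqP; split=> [_ [p [x [x0 xx xY px]] <-]|q [y [y0 yy yY qy]]].
  exists (f x); rewrite nz // cf xx mulr0; split=> //; first exact: memv_img.
  by rewrite fg px limg_line.
move: yY y0 yy qy => /memv_imgP[x xY ->] fx0 /eqP; rewrite cf mulf_eq0 (negbTE c0) /=.
move=> /eqP xx qx; have x0 : x != 0 by apply: contraNneq fx0 => ->; rewrite linear0.
exists (point_of x0); first exact: sphere_of_point.
by apply: val_inj; rewrite fg [RHS]qx /= limg_line.
Qed.

Lemma moebius_spaceE : moebius_space b = sphere_of b fullv.
Proof.
apply/seteqP; split=> p [x]; first by case=> *; exists x; rewrite memvf.
by case=> *; exists x.
Qed.

Fact dim_proj_map f (f0 : lker f = 0%VS) (p : proj_point V) : \dim (f @: val p) == 1%N.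
Proof. by rewrite limg_dim_eq ?f0 ?capv0 //; case: p. Qed.

Definition proj_map f (f0 : lker f = 0%VS) (p : proj_point V) : proj_point V :=
  exist _ (f @: val p)%VS (dim_proj_map f0 p).

Lemma isometric_moebius f : isometric b f ->
  exists2 g, moebius_group b g & induces f g.
Proof.
move=> isof; have f0 := isometric_inj b_nondeg isof.
exists (proj_map f0) => //; split; first by exists f.
rewrite moebius_spaceE (image_sphere_of (f := f) (c := 1)) ?oner_eq0 //; last first.
  exact: isometric_conformal.
congr (sphere_of b _); apply/eqP; rewrite eqEdim subvf limg_dim_eq.
  by rewrite leqnn.
by rewrite f0 capv0.
Qed.

Section NullCone.
Hypothesis b_index1 : has_index b fullv 1.

(** A linear map preserving the null cone is conformal.  Let e be a negative vector
    and u a vector orthogonal to e, scaled so that e + u and e - u are null.  The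
    images of these two are null, which says that f u and f e are orthogonal and
    have opposite norms: f multiplies the norms of e and of u by the same c. *)
Lemma null_cone_conformal f : lker f = 0%VS ->
    (forall x, b x x = 0 -> b (f x) (f x) = 0) ->
  exists2 c, c != 0 & conformal f c.
Proof.
move=> f0 fnull; have [e _ ee] := index_one_negative b_index1.
pose c := b (f e) (f e) / b e e.
have key u : b u e = 0 -> b (f u) (f e) = 0 /\ b (f u) (f u) = c * b u u.
  move=> ue; have [->|u0] := eqVneq u 0.
    by rewrite linear0 !form0l mulr0.
  have uu := orthogonal_negative_gt0 b_nondeg b_index1 ee ue u0.
  have [s [s0 ss nullb]] := null_combinations b_nondeg b_index1 ee ue u0.
  have null t : t * t = s * s -> b (f (e + t *: u)) (f (e + t *: u)) = 0.
    by move=> /nullb/fnull.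
  have := null s erefl; have := null (- s) (mulrNN s s).
  rewrite !linearD !linearZ /= !formE (formC b (f e) (f u)) => m p.
  split.
    have /eqP : 4 * s * b (f u) (f e) = 0 by lra.
    by rewrite !mulf_eq0 pnatr_eq0 (negbTE s0) => /eqP.
  have : s * s * b (f u) (f u) = - b (f e) (f e) by lra.
  rewrite ss /c => h; apply: (mulfI (x := - b e e / b u u)).
    by rewrite -ss mulf_neq0.
  rewrite h; field; by rewrite lt_eqF // gt_eqF.
have quad x : b (f x) (f x) = c * b x x.
  pose a := b x e / b e e; pose u := x - a *: e.
  have ue : b u e = 0 by rewrite /u /a !formE; field; rewrite lt_eqF.
  have [fue fuu] := key u ue.
  have -> : x = u + a *: e by rewrite subrK.
  clearbody u; rewrite linearD linearZ /= !formE (formC b (f e)) (formC b e) fue ue fuu.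
  by rewrite /c; field; rewrite lt_eqF.
(* polarisation *)
have cf : conformal f c.
  move=> x y; have := quad (x + y); rewrite linearD /= !formE !quad.
  rewrite (formC b (f y)) (formC b y) => ?; lra.
exists c => //; apply: contraTneq ee => c0.
suff -> : e = 0 by rewrite form0l ltxx.
have := f0 => /eqP/lker0_lfunK fK.
have : f e = 0.
  apply: (nondegenerateP b_nondeg) => y.
  have : y \in (f @: fullv)%VS.
    suff -> : (f @: fullv = fullv)%VS by rewrite memvf.
    by apply/eqP; rewrite eqEdim subvf limg_dim_eq ?f0 ?capv0 ?leqnn.
  by case/memv_imgP => z _ ->; rewrite cf c0 mul0r.
by move/(congr1 f^-1%VF); rewrite fK linear0.
Qed.

Lemma induced_null f g : lker f = 0%VS -> induces f g ->
  g @` moebius_space b = moebius_space b ->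
  forall x, b x x = 0 -> b (f x) (f x) = 0.
Proof.
move=> f0 fg gM x xx; have [->|x0] := eqVneq x 0; first by rewrite linear0 form0l.
have : moebius_space b (g (point_of x0)).
  by rewrite -gM; exists (point_of x0) => //; exists x.
case=> y [y0 yy]; rewrite fg /= limg_line => xy.
have : f x \in <[y]>%VS by rewrite -xy memv_line.
by case/vlineP => a ->; rewrite !formE yy !mulr0.
Qed.

Lemma induced_subspace f g Y Z : lker f = 0%VS -> induces f g ->
    pseudo_euclidean b Y -> (1 < \dim Y)%N -> \dim Y = \dim Z ->
    g @` sphere_of b Y = sphere_of b Z ->
  (f @: Y)%VS = Z.
Proof.
move=> f0 fg Yp dY dYZ gY.
apply/eqP; rewrite eqEdim limg_dim_eq ?f0 ?capv0 // dYZ leqnn andbT.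
suff /subvP YZ : (Y <= f @^-1: Z)%VS.
  by apply/subvP => _ /memv_imgP[x /YZ + ->]; rewrite memv_preim.
apply: null_vectors_span Yp dY _ => // x xY xx; rewrite -memv_preim.
have [->|x0] := eqVneq x 0; first by rewrite linear0 mem0v.
have : sphere_of b Z (g (point_of x0)).
  by rewrite -gY; exists (point_of x0) => //; apply: sphere_of_point.
by case=> y [_ _ yZ]; rewrite fg /= limg_line memvE => ->; rewrite -memvE.
Qed.

End NullCone.
End Conformal.

(** * Congruence of pairs with the same eigenvalues *)

Section Invariants.
Variables (R : realType) (V : vectType R) (b : {symmetric V}).
Hypothesis b_nondeg : nondegenerate b.
Implicit Types (x y u v : V) (Y W U : {vspace V}).

Lemma orthogonal_free (s : seq V) : uniq s -> orthogonal_family b s ->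
  {in s, forall u, b u u != 0} -> free s.
Proof.
elim: s => [|x s IHs] /=; first by rewrite nil_free.
case/andP=> xs us o nn; rewrite free_cons; apply/andP; split; last first.
  apply: IHs => // [u v uin vin|u uin]; first by apply: o; rewrite in_cons ?uin ?vin orbT.
  by apply: nn; rewrite in_cons uin orbT.
apply/negP => xs_span; have /negP[] := nn x (mem_head _ _).
apply/eqP; apply: orthov_form xs_span; apply/mem_orthov_span => u uin.
by apply: o; rewrite ?mem_head ?in_cons ?uin ?orbT //; apply: contraNneq xs => ->.
Qed.

Section AdaptedFamily.
Variables (W U : {vspace V}) (es : seq V).
Hypotheses (W_nondeg : nondegenerate_on b W) (U_nondeg : nondegenerate_on b U).
Hypothesis U_pos : euclidean b (orthov b U).
Hypothesis WU0 : (orthov b W :&: orthov b U = 0)%VS.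
Hypothesis es_on : orthonormal_basis b (orthov b W) es.
Hypothesis es_eig : {in es, forall e, perp2 b W U e = b (perp2 b W U e) e *: e}.

(** The shadow of an eigenvector e is its projection onto the complement of U, and
    its remnant is the component in U.  Shadows are again orthogonal, and the norm
    of the shadow of e is its eigenvalue; so the remnants are orthogonal as well, of
    norms one minus the eigenvalues.  The zero shadows are left out and replaced by
    an orthonormal basis hs of the part of the complement of U that is orthogonal
    to all shadows.  The shadows, hs and the remnants form an orthogonal family
    whose norms depend on the eigenvalues alone; the complements of W and of U can
    both be read off from it. *)
Definition shadows := [seq perp b U e | e <- es & perp b U e != 0].
Definition remnants := [seq e - perp b U e | e <- es].
Definition shadow_compl := (orthov b U :&: orthov b <<shadows>>)%VS.

Lemma shadow_form : {in es &, forall e e', e != e' -> b (perp b U e) (perp b U e') = 0}.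
Proof.
have [es_basis es_o _] := es_on.
move=> e e' ee ee' ne; rewrite -(form_perp2 b_nondeg W_nondeg U_nondeg); last first.
  exact: (basis_mem es_basis).
by rewrite es_eig // formE es_o // mulr0.
Qed.

Lemma shadow_norm : {in es, forall e, b (perp b U e) (perp b U e) = b (perp2 b W U e) e}.
Proof.
have [es_basis _ _] := es_on.
by move=> e ee; rewrite (form_perp2 b_nondeg) // (basis_mem es_basis).
Qed.

Lemma remnant_norm : {in es, forall e,
  b (e - perp b U e) (e - perp b U e) = 1 - b (perp2 b W U e) e}.
Proof.
move=> e ee; have [_ _ es_1] := es_on; rewrite -shadow_norm //.
have := form_perpl b_nondeg U_nondeg e (perp_mem b U e); rewrite !formE (es_1 e ee).
by rewrite (formC b (perp b U e) e) => <-; ring.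
Qed.

Lemma shadows_orthogonal : orthogonal_family b shadows.
Proof.
move=> _ _ /mapP[e + ->] /mapP[e' + ->]; rewrite !mem_filter => /andP[_ ee] /andP[_ ee'] ne.
by apply: shadow_form => //; apply: contraNneq ne => ->.
Qed.

Lemma shadow_nonnull e : perp b U e != 0 -> b (perp b U e) (perp b U e) != 0.
Proof. by move=> e0; rewrite gt_eqF // U_pos // perp_mem. Qed.

Lemma shadows_free : free shadows.
Proof.
have [es_basis _ _] := es_on.
apply: orthogonal_free; first last.
- by move=> _ /mapP[e + ->]; rewrite mem_filter => /andP[/shadow_nonnull].
- exact: shadows_orthogonal.
rewrite map_inj_in_uniq ?filter_uniq ?free_uniq ?(basis_free es_basis) // => e e'.
rewrite !mem_filter => /andP[e0 ee] /andP[_ ee'] eqp; apply/eqP; apply: contraT => ne.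
by have /eqP := shadow_form ee ee' ne; rewrite -eqp (negbTE (shadow_nonnull e0)).
Qed.

Lemma shadows_sub : (<<shadows>> <= orthov b U)%VS.
Proof. by apply/span_subvP => _ /mapP[e _ ->]; apply: perp_mem. Qed.

Lemma shadow_cap0 : (<<shadows>> :&: shadow_compl = 0)%VS.
Proof.
apply/eqP; rewrite -subv0; apply/subvP => x; rewrite !memv_cap memv0.
case/and3P => xs xU xo; apply/eqP/(euclidean_eq0 U_pos xU).
exact: orthov_form xo xs.
Qed.

Lemma shadow_add : (<<shadows>> + shadow_compl = orthov b U)%VS.
Proof.
apply/eqP; rewrite eqEdim subv_add shadows_sub capvSl /=.
rewrite dimv_disjoint_sum ?shadow_cap0 // addnC; exact: dim_cap_orthov_ge.
Qed.

Lemma dim_shadow_compl : (size shadows + \dim shadow_compl = \dim (orthov b U))%N.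
Proof.
by rewrite -shadow_add dimv_disjoint_sum ?shadow_cap0 // (eqP shadows_free).
Qed.

Variable hs : seq V.
Hypothesis hs_on : orthonormal_basis b shadow_compl hs.

Lemma shadow_basis : basis_of (orthov b U) (shadows ++ hs).
Proof.
have [hs_basis _ _] := hs_on.
rewrite /basis_of span_cat (span_basis hs_basis) shadow_add eqxx /=.
rewrite cat_free shadows_free (basis_free hs_basis) /=; apply/directv_addP.
by rewrite (span_basis hs_basis) shadow_cap0.
Qed.

Lemma remnants_sub : {in remnants, forall u, u \in U}.
Proof. by move=> _ /mapP[e _ ->]; apply: perp_compl. Qed.

Lemma remnants_free : free remnants.
Proof.
have [es_basis _ _] := es_on.
have -> : remnants = map (\1 - perp b U)%VF es.
  by apply: eq_map => e; rewrite add_lfunE opp_lfunE id_lfunE.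
apply/basis_free/limg_basis_of/es_basis.
apply/eqP; rewrite -subv0 -WU0; apply/subvP => e; rewrite !memv_cap memv_ker.
rewrite add_lfunE opp_lfunE id_lfunE subr_eq0 => /andP[-> /eqP->].
exact: perp_mem.
Qed.

(** The remnants lie in U, the rest of the family in its orthogonal space. *)
Lemma adapted_family_free : free ((shadows ++ hs) ++ remnants).
Proof.
rewrite cat_free (basis_free shadow_basis) remnants_free /=; apply/directv_addP.
rewrite (span_basis shadow_basis); apply/eqP; rewrite -subv0 -(orthov_cap0 U_nondeg).
by apply: capvS => //; apply/span_subvP/remnants_sub.
Qed.

Lemma adapted_family_orthogonal : orthogonal_family b ((shadows ++ hs) ++ remnants).
Proof.
have [hs_basis hs_o _] := hs_on; have [es_basis es_o es_1] := es_on.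
have shU u : u \in shadows ++ hs -> u \in orthov b U by apply: (basis_mem shadow_basis).
have hsC u : u \in hs -> {in shadows, forall v, b u v = 0}.
  move=> /(basis_mem hs_basis); rewrite memv_cap => /andP[_ uo] v vs.
  by apply: orthov_form uo _; apply: memv_span.
have sym u v : b u v = 0 -> b v u = 0 by rewrite formC.
move=> u v; rewrite !(mem_cat _ _ remnants) => /orP[usu|ur] /orP[vsh|vr] ne.
- move: usu vsh; rewrite !mem_cat => /orP[us|uh] /orP[vs|vh].
  + exact: shadows_orthogonal.
  + by apply/sym/hsC.
  + exact: hsC.
  + exact: hs_o.
- exact: orthov_form (shU _ usu) (remnants_sub vr).
- by apply/sym/(orthov_form (shU _ vsh) (remnants_sub ur)).
move: ur vr ne => /mapP[e ee ->] /mapP[e' ee' ->] ne.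
have ne' : e != e' by apply: contraNneq ne => ->.
have := form_perpl b_nondeg U_nondeg e (perp_mem b U e').
have := form_perpl b_nondeg U_nondeg e' (perp_mem b U e).
rewrite (formC b (perp b U e')) (formC b e') !formE (es_o e e') // shadow_form // => <- <-.
by ring.
Qed.

End AdaptedFamily.

(** Witt's theorem applies to the two adapted families.  The isometry maps e, the sum
    of its shadow and its remnant, to the corresponding eigenvector e', so it maps
    the complement of W to that of W'; and it maps the basis of the complement of U
    formed by the shadows and hs to its counterpart. *)
Lemma isometry_of_pairs W U W' U' (eps : seq (V * V)) :
    nondegenerate_on b W -> nondegenerate_on b U ->
    nondegenerate_on b W' -> nondegenerate_on b U' ->
    euclidean b (orthov b U) -> euclidean b (orthov b U') ->
    (orthov b W :&: orthov b U = 0)%VS -> (orthov b W' :&: orthov b U' = 0)%VS ->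
    \dim U = \dim U' ->
    orthonormal_basis b (orthov b W) (unzip1 eps) ->
    orthonormal_basis b (orthov b W') (unzip2 eps) ->
    {in unzip1 eps, forall e, perp2 b W U e = b (perp2 b W U e) e *: e} ->
    {in unzip2 eps, forall e, perp2 b W' U' e = b (perp2 b W' U' e) e *: e} ->
    {in eps, forall p, b (perp2 b W U p.1) p.1 = b (perp2 b W' U' p.2) p.2} ->
  exists f, [/\ isometric b f, (f @: W = W')%VS & (f @: U = U')%VS].
Proof.
move=> Wn Un Wn' Un' Up Up' WU WU' dU on on' eig eig' lam.
have in1 p : p \in eps -> p.1 \in unzip1 eps by apply: map_f.
have in2 p : p \in eps -> p.2 \in unzip2 eps by apply: map_f.
have norm p : p \in eps ->
    b (perp b U p.1) (perp b U p.1) = b (perp b U' p.2) (perp b U' p.2).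
  by move=> pe; rewrite (shadow_norm Wn Un on) ?(shadow_norm Wn' Un' on') ?lam ?in1 ?in2.
have zero p : p \in eps -> (perp b U p.1 == 0) = (perp b U' p.2 == 0).
  move=> pe; have := norm p pe => nrm; apply/eqP/eqP => z; move: nrm; rewrite z form0l => nrm.
    by apply: (euclidean_eq0 Up'); rewrite ?perp_mem.
  by apply: (euclidean_eq0 Up); rewrite ?perp_mem.
pose gps := [seq (perp b U p.1, perp b U' p.2) | p <- eps & perp b U p.1 != 0].
pose rps := [seq (p.1 - perp b U p.1, p.2 - perp b U' p.2) | p <- eps].
have gps1 : unzip1 gps = shadows U (unzip1 eps).
  by rewrite /shadows filter_map /unzip1 -!map_comp.
have gps2 : unzip2 gps = shadows U' (unzip2 eps).
  rewrite /shadows filter_map /unzip2 -!map_comp; congr map.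
  by apply: eq_in_filter => p pe /=; rewrite zero.
have rps1 : unzip1 rps = remnants U (unzip1 eps).
  by rewrite /remnants /unzip1 -!map_comp.
have rps2 : unzip2 rps = remnants U' (unzip2 eps).
  by rewrite /remnants /unzip2 -!map_comp.
have [hs hs_on] : exists hs, orthonormal_basis b (shadow_compl U (unzip1 eps)) hs.
  by apply: orthonormal_basis_exists; apply: euclideanS Up; apply: capvSl.
have [hs' hs_on'] : exists hs, orthonormal_basis b (shadow_compl U' (unzip2 eps)) hs.
  by apply: orthonormal_basis_exists; apply: euclideanS Up'; apply: capvSl.
have szh : size hs = size hs'.
  have [hb _ _] := hs_on; have [hb' _ _] := hs_on'.
  have := dim_shadow_compl Wn Un Up on eig; have := dim_shadow_compl Wn' Un' Up' on' eig'.
  rewrite -(span_basis hb) -(span_basis hb') (eqP (basis_free hb)) (eqP (basis_free hb')).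
  rewrite -gps1 -gps2 !size_map.
  have := dim_orthov b_nondeg U; have := dim_orthov b_nondeg U'; rewrite dU.
  by move=> <- /addIn -> <- /addnI.
have z1 : unzip1 (zip hs hs') = hs by rewrite unzip1_zip ?szh.
have z2 : unzip2 (zip hs hs') = hs' by rewrite unzip2_zip ?szh.
have two0 : 2 != 0 :> R by rewrite pnatr_eq0.
have [|||||f isof fps] := witt_extension b_nondeg two0 (ps := (gps ++ zip hs hs') ++ rps).
- rewrite /unzip1 !map_cat -/unzip1 gps1 z1 rps1.
  exact: (adapted_family_free Wn Un Up WU on eig hs_on).
- rewrite /unzip2 !map_cat -/unzip2 gps2 z2 rps2.
  exact: (adapted_family_free Wn' Un' Up' WU' on' eig' hs_on').
- rewrite /unzip1 !map_cat -/unzip1 gps1 z1 rps1.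
  exact: (adapted_family_orthogonal Wn Un Up on eig hs_on).
- rewrite /unzip2 !map_cat -/unzip2 gps2 z2 rps2.
  exact: (adapted_family_orthogonal Wn' Un' Up' on' eig' hs_on').
- move=> p; rewrite !mem_cat => /orP[/orP[/mapP[q + ->]|ph]|/mapP[q qe ->]] /=.
  + by rewrite mem_filter => /andP[_ /norm].
  + have [_ _ h1] := hs_on; have [_ _ h1'] := hs_on'.
    have p1 : p.1 \in hs by have := map_f fst ph; rewrite [map _ _]z1.
    have p2 : p.2 \in hs' by have := map_f snd ph; rewrite [map _ _]z2.
    by rewrite (h1 _ p1) (h1' _ p2).
  + by rewrite (remnant_norm Wn Un on) ?(remnant_norm Wn' Un' on') ?lam ?in1 ?in2.
have f0 := isometric_inj b_nondeg isof.
have fsh p : p \in eps -> f (perp b U p.1) = perp b U' p.2.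
  move=> pe; have [z|nz] := eqVneq (perp b U p.1) 0.
    by have := zero p pe; rewrite z eqxx linear0 => /esym/eqP.
  apply: (fps (_, _)); rewrite !mem_cat; apply/orP; left; apply/orP; left.
  by apply/mapP; exists p; rewrite ?mem_filter ?nz.
have fe p : p \in eps -> f p.1 = p.2.
  move=> pe; rewrite -[p.1](subrK (perp b U p.1)) linearD /= fsh //.
  rewrite (fps (_, p.2 - perp b U' p.2)) ?subrK // !mem_cat; apply/orP; right.
  by apply/mapP; exists p.
have fW : (f @: orthov b W = orthov b W')%VS.
  have [eb _ _] := on; have [eb' _ _] := on'.
  rewrite -(span_basis eb) -(span_basis eb') limg_span; congr (<<_>>)%VS.
  by rewrite /unzip1 /unzip2 -map_comp; apply/eq_in_map => p /fe.
have fU : (f @: orthov b U = orthov b U')%VS.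
  have B := shadow_basis Wn Un Up on eig hs_on.
  have B' := shadow_basis Wn' Un' Up' on' eig' hs_on'.
  rewrite -(span_basis B) -(span_basis B') limg_span; congr (<<_>>)%VS.
  have -> : shadows U (unzip1 eps) ++ hs = unzip1 (gps ++ zip hs hs').
    by rewrite /unzip1 map_cat -/unzip1 gps1 z1.
  have -> : shadows U' (unzip2 eps) ++ hs' = unzip2 (gps ++ zip hs hs').
    by rewrite /unzip2 map_cat -/unzip2 gps2 z2.
  rewrite /unzip1 /unzip2 -map_comp.
  by apply/eq_in_map => p pin; apply: fps; rewrite mem_cat pin.
have back Y Y' : (f @: orthov b Y = orthov b Y')%VS -> (f @: Y = Y')%VS.
  move=> fY; rewrite -[Y](orthovK b_nondeg) -[Y'](orthovK b_nondeg) -fY.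
  exact: conformal_orthov (oner_neq0 R) (isometric_conformal isof).
by exists f; split=> //; apply: back.
Qed.

End Invariants.

Section CongruentPairs.
Variables (R : realType) (V : vectType R) (b : {symmetric V}).
Hypothesis b_nondeg : nondegenerate b.
Implicit Types (W U : {vspace V}) (f : 'End(V)).

Lemma eigenvalue_list_unique (E : vectType R) (A : 'End(E)) (alpha alpha' : seq R) :
  eigenvalue_list A alpha -> eigenvalue_list A alpha' -> alpha = alpha'.
Proof.
move=> [s p] [s' p']; apply: (sorted_eq _ _ s s').
- by move=> x y z xy yz; apply: le_trans yz xy.
- by move=> x y; rewrite andbC => /le_anti.
- by apply: prod_XsubC_eq; rewrite -p -p'.
Qed.

(** Conformal maps commute with the projections, so they carry an eigenbasis of the
    operator of the pair to an eigenbasis with the same eigenvalues. *)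
Lemma conformal_eigenvalue_list W U f c (alpha : seq R) :
    lker f = 0%VS -> c != 0 -> conformal b f c ->
    nondegenerate_on b W -> nondegenerate_on b U ->
    nondegenerate_on b (f @: W) -> nondegenerate_on b (f @: U) ->
    euclidean b (orthov b W) ->
    eigenvalue_list (pair_operator b W U) alpha ->
  eigenvalue_list (pair_operator b (f @: W) (f @: U)) alpha.
Proof.
move=> f0 c0 cf Wn Un fWn fUn Wp ea; split; first by case: ea.
have [es [[es_basis _ _] es_eig <-]] := eigenvalue_listP b_nondeg Wn Un Wp ea.
have fK := lker0_lfunK (introT eqP f0).
rewrite (char_poly_pair_operator (es := map f es)
    (lam := fun e => b (perp2 b W U (f^-1%VF e)) (f^-1%VF e))).
- by rewrite -map_comp; congr (\prod_(a <- _) _); apply: eq_map => e /=; rewrite fK.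
- rewrite -(conformal_orthov b_nondeg W f0 c0 cf); apply: limg_basis_of => //.
  by rewrite f0 capv0.
- move=> _ /mapP[e ee ->]; rewrite fK.
  transitivity (f (perp2 b W U e)); last by rewrite {1}es_eig // linearZ.
  rewrite /perp2 comp_lfunE (conformal_perp b_nondeg e f0 c0 cf Un fUn).
  by rewrite (conformal_perp b_nondeg _ f0 c0 cf Wn fWn) comp_lfunE.
Qed.

End CongruentPairs.

(** * Mutual position of two spheres *)

Section MutualPosition.
Variables (R : realType) (V : vectType R) (b : {symmetric V}).
Hypothesis b_nondeg : nondegenerate b.
Implicit Types (A : 'End(V)) (x y e u : V) (W U : {vspace V}).

Lemma eigenbasis_form_lt A (es : seq V) :
    free es -> orthogonal_family b es -> {in es, forall e, b e e = 1} ->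
    {in es, forall e, A e = b (A e) e *: e} -> {in es, forall e, b (A e) e < 1} ->
  {in <<es>>%VS, forall x, x != 0 -> b (A x) x < b x x}.
Proof.
move=> fr o e1 eig lt1 x xs.
suff [//] : A x \in <<es>>%VS /\ (x != 0 -> b (A x) x < b x x).
elim: es x fr o e1 eig lt1 xs => [|e es IHes] x.
  by rewrite span_nil memv0 => _ _ _ _ _ /eqP->; rewrite linear0 mem0v eqxx.
rewrite free_cons span_cons => /andP[eN fr] o e1 eig lt1.
case/memv_addP=> _ /vlineP[a ->] [y yes ->].
have sub u : u \in es -> u \in e :: es by rewrite in_cons orbC => ->.
have [||||Ay lty] := IHes y fr _ _ _ _ yes.
- by move=> u v ues ves; apply: o; apply: sub.
- by move=> u /sub; apply: e1.
- by move=> u /sub; apply: eig.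
- by move=> u /sub; apply: lt1.
have eo : e \in orthov b <<es>>.
  apply/mem_orthov_span => u ues; apply: o; rewrite ?mem_head ?sub //.
  by apply: contraNneq eN => ->; apply: memv_span.
have Ae := eig e (mem_head _ _); set lam := b (A e) e in Ae.
have lam1 : lam < 1 by apply: lt1; apply: mem_head.
have ee : b e e = 1 by apply: e1; apply: mem_head.
rewrite linearD linearZ /= Ae; split.
  by rewrite scalerA memv_add ?memvZ ?memv_line.
rewrite !formE ee (formC b y) (formC b (A y)).
rewrite (orthov_form eo yes) (orthov_form eo Ay).
move=> nz; have [y0|y0] := eqVneq y 0.
  have a0 : a != 0 by apply: contraNneq nz => ->; rewrite y0 scale0r addr0.
  have : 0 < a ^+ 2 by rewrite lt0r sqr_ge0 sqrf_eq0 a0.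
  by rewrite y0 linear0 !form0l; nra.
by have := lty y0; have := sqr_ge0 a; nra.
Qed.

Hypothesis b_index1 : has_index b fullv 1.
Variables (W U : {vspace V}).
Hypotheses (W_pseudo : pseudo_euclidean b W) (U_pseudo : pseudo_euclidean b U).
Hypothesis WU0 : (orthov b W :&: orthov b U = 0)%VS.

Let W_nondeg : nondegenerate_on b W := proj1 W_pseudo.
Let U_nondeg : nondegenerate_on b U := proj1 U_pseudo.

Lemma orthov_pseudo_euclidean Y : pseudo_euclidean b Y -> euclidean b (orthov b Y).
Proof.
case/(pseudo_euclideanP b_nondeg b_index1) => v vY vv.
exact (orthov_negative_euclidean b_nondeg b_index1 vY vv).
Qed.

Let W_pos : euclidean b (orthov b W) := orthov_pseudo_euclidean W_pseudo.
Let U_pos : euclidean b (orthov b U) := orthov_pseudo_euclidean U_pseudo.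

(** General position means that W and U together span V. *)
Lemma dim_cap_general_position : (\dim (U :&: W) + \dim {:V} = \dim W + \dim U)%N.
Proof.
have : \dim (W + U) = \dim {:V}.
  have := dim_orthov b_nondeg (W + U)%VS.
  by rewrite orthov_cap WU0 dimv0 add0n.
by move=> <-; rewrite addnC capvC dimv_sum_cap.
Qed.

Section Eigenvector.
Variables (e : V) (a : R).
Hypotheses (eW : e \in orthov b W) (e0 : e != 0) (e_eig : perp2 b W U e = a *: e).
Let r := e - perp b U e.

Lemma remnant_mem : r \in U.
Proof. exact: perp_compl. Qed.

(** The remnant r of an eigenvector e decides on the position of the two spheres: it
    is orthogonal to the intersection of U and W, and it is negative, null or
    positive according to the position of the eigenvalue a with respect to 1. *)
Lemma remnant_form : b r r = (1 - a) * b e e.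
Proof.
have := form_perpl b_nondeg U_nondeg e (perp_mem b U e).
have := form_perp2 b_nondeg W_nondeg U_nondeg e eW.
rewrite e_eig /r !formE (formC b (perp b U e) e) => <- <-.
by ring.
Qed.

Lemma remnant_orthogonal : (U :&: W <= orthov b <[r]>)%VS.
Proof.
apply/subvP => x; rewrite memv_cap mem_orthov1 => /andP[xU xW].
rewrite formC /r formDl formNl (orthov_form eW xW).
by rewrite (orthov_form (perp_mem b U e) xU) subr0.
Qed.

(** If r were zero, then e would be orthogonal to both W and U. *)
Lemma remnant_neq0 : r != 0.
Proof.
apply: contra e0 => /eqP r0.
suff : e \in (orthov b W :&: orthov b U)%VS by rewrite WU0 memv0.
by rewrite memv_cap eW -[e](subrK (perp b U e)) -/r r0 add0r perp_mem.
Qed.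

Lemma remnant_negative_euclidean : 1 < a -> euclidean b (orthov b <[r]>).
Proof.
move=> a1; apply: (orthov_negative_euclidean b_nondeg b_index1 (memv_line r)).
by rewrite remnant_form; have := W_pos eW e0; nra.
Qed.

(** The hyperspheres are those orthogonal to e and to its projection onto the
    complement of U.  A common null vector would be orthogonal to the difference r
    of these two vectors, which is negative. *)
Lemma separating_hyperspheres : (2 < \dim {:V})%N -> 1 < a ->
  exists Sigma1 Sigma2 : set (proj_point V),
    [/\ hypersphere b Sigma1, hypersphere b Sigma2,
        sphere_of b W `<=` Sigma1, sphere_of b U `<=` Sigma2 &
        Sigma1 `&` Sigma2 = set0].
Proof.
move=> dimV3 a1; have ee := W_pos eW e0.
have f0 : perp b U e != 0.
  apply: contraTneq a1 => f0; have := remnant_form.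
  by rewrite /r f0 subr0 -leNgt => h; nra.
have ff := U_pos (perp_mem b U e) f0.
exists (sphere_of b (orthov b <[e]>)), (sphere_of b (orthov b <[perp b U e]>)).
split.
- exact: hypersphere_orthov.
- exact: hypersphere_orthov.
- by apply: sphere_ofS; rewrite -mem_orthov_sym.
- by apply: sphere_ofS; rewrite -mem_orthov_sym perp_mem.
rewrite sphere_of_cap; apply: sphere_of_euclidean.
apply: euclideanS (remnant_negative_euclidean a1); apply/subvP => x.
rewrite memv_cap !mem_orthov1 => /andP[/eqP xf /eqP xe].
by rewrite /r !formE xf xe subrr.
Qed.

(** The projection of r onto the complement of W is e - Ae, which vanishes. *)
Lemma remnant_tangent : a = 1 -> r \in (U :&: W)%VS /\ b r r = 0.
Proof.
move=> a1; rewrite remnant_form a1 subrr mul0r memv_cap remnant_mem; split=> //=.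
have pr0 : perp b W r = 0.
  have -> : perp b W r = e - perp2 b W U e.
    rewrite /r linearB /= lfunE /=; congr (_ - _).
    by apply: perp_unique => //; rewrite subrr mem0v.
  by rewrite e_eig a1 scale1r subrr.
by have := perp_compl b_nondeg W_nondeg r; rewrite pr0 subr0.
Qed.

End Eigenvector.

(** For e in the complement of W and f in that of U, the norm of e + f is at least
    the norm of e minus that of its projection onto the complement of U, that is,
    at least b(e - Ae, e).  So the sum K of the two complements is positive
    definite, and a negative vector must have a negative component in the
    orthogonal space of K, which is the intersection of U and W. *)
Lemma small_eigenvalues_pseudo_euclidean :
    (forall a, leigenvalue (pair_operator b W U) a -> a < 1) ->
  pseudo_euclidean b (U :&: W)%VS.
Proof.
move=> lt1; pose K := (orthov b W + orthov b U)%VS.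
have [es [[es_basis es_o es_1] es_eig]] := perp2_spectral b_nondeg W_nondeg U_nondeg W_pos.
have esW := basis_mem es_basis.
have small e : e \in orthov b W -> e != 0 -> b (perp2 b W U e) e < b e e.
  rewrite -(span_basis es_basis); apply: eigenbasis_form_lt => //.
    exact: basis_free es_basis.
  move=> u ues; apply: lt1; apply/leigenvalueP => //; exists u; split.
  - exact: esW.
  - by apply: contraTneq (oner_neq0 R) => u0; rewrite -(es_1 u ues) u0 form0l eqxx.
  - exact: es_eig.
have K_pos : euclidean b K.
  move=> _ /memv_addP[e eW [f fU ->]] nz.
  have [e0|e0] := eqVneq e 0; first by move: nz; rewrite e0 add0r; apply: U_pos.
  have lt := small e eW e0; have := euclidean_ge0 U_pos (memvD fU (perp_mem b U e)).
  have := form_perpl b_nondeg U_nondeg e fU.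
  move: lt; rewrite (form_perp2 b_nondeg W_nondeg U_nondeg) //.
  rewrite !formE (formC b f e) (formC b f (perp b U e)) => lt -> ge.
  by lra.
have K_nondeg : nondegenerate_on b K.
  apply/eqP; rewrite -subv0; apply/subvP => x; rewrite memv_cap memv0 => /andP[xK xo].
  by apply/eqP/(euclidean_eq0 K_pos xK); apply: orthov_form xo xK.
have KE : orthov b K = (U :&: W)%VS by rewrite orthov_cap !orthovK // capvC.
apply/pseudo_euclideanP => //; have [v _ vv] := index_one_negative b_index1.
have : v \in (orthov b K + K)%VS by rewrite orthov_add // memvf.
case/memv_addP => p pK [k kK vE]; exists p; rewrite -?KE //.
move: vv; rewrite vE !formE (formC b k) (orthov_form pK kK).
by have := euclidean_ge0 K_pos kK; lra.
Qed.

(** The subspaces of the two hyperspheres meet in a space of dimension at least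
    dim V - 2, that is, at least 2, which contains a negative vector of the
    intersection of U and W.  Such a space is spanned by its null vectors, so it
    contains some. *)
Lemma interlaced_hyperspheres (Sigma1 Sigma2 : set (proj_point V)) :
    (1 < \dim W)%N -> (1 < \dim U)%N -> (3 < \dim {:V})%N ->
    pseudo_euclidean b (U :&: W)%VS ->
    hypersphere b Sigma1 -> hypersphere b Sigma2 ->
    sphere_of b W `<=` Sigma1 -> sphere_of b U `<=` Sigma2 ->
  Sigma1 `&` Sigma2 <> set0.
Proof.
move=> dW dU dV4 /(pseudo_euclideanP b_nondeg b_index1)[v vUW vv].
move=> [Y1 [Y1p dY1 ->]] [Y2 [Y2p dY2 ->]].
move=> /(sphere_of_sub b_nondeg b_index1 W_pseudo dW) WY1.
move=> /(sphere_of_sub b_nondeg b_index1 U_pseudo dU) UY2.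
rewrite sphere_of_cap => empty; set Y := (Y2 :&: Y1)%VS in empty.
have vY : v \in Y.
  by move: vUW; rewrite !memv_cap => /andP[/(subvP UY2)-> /(subvP WY1)->].
have Yp : pseudo_euclidean b Y by apply/pseudo_euclideanP => //; exists v.
have dY : (1 < \dim Y)%N.
  have := dimv_sum_cap Y2 Y1; have := dimvS (subvf (Y2 + Y1)); rewrite -/Y; lia.
have : (Y <= 0)%VS.
  apply: (null_vectors_span b_nondeg b_index1 Yp dY) => x xY xx; rewrite memv0.
  apply: contraT => x0; have : sphere_of b Y (point_of x0) by apply: sphere_of_point.
  by rewrite empty.
by rewrite subv0 => /eqP Y0; move: dY; rewrite Y0 dimv0.
Qed.

Lemma pseudo_euclidean_not_euclidean Y : pseudo_euclidean b Y -> ~ euclidean b Y.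
Proof.
move=> /(pseudo_euclideanP b_nondeg b_index1)[v vY vv] /(_ v vY) h.
have v0 : v != 0 by apply: contraTneq vv => ->; rewrite form0l ltxx.
by move: (h v0); lra.
Qed.

Lemma euclidean_nondegenerate Y : euclidean b Y -> nondegenerate_on b Y.
Proof.
move=> pos; apply/eqP; rewrite -subv0; apply/subvP => x.
rewrite memv_cap memv0 => /andP[xY xo]; apply/eqP/(euclidean_eq0 pos xY).
exact: orthov_form xo xY.
Qed.

Lemma sphere_of_pseudo_line Y : pseudo_euclidean b Y -> \dim Y = 1%N ->
  sphere_of b Y = set0.
Proof.
move=> /(pseudo_euclideanP b_nondeg b_index1)[v vY vv] dY.
have v0 : v != 0 by apply: contraTneq vv => ->; rewrite form0l ltxx.
have YE : (<[v]> = Y)%VS by apply/eqP; rewrite eqEdim dY dim_vline v0 -memvE vY.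
apply/seteqP; split=> // p [x [x0 xx + _]]; rewrite -YE => /vlineP[a xE].
move: x0 xx; rewrite xE scaler_eq0 negb_or !formE => /andP[a0 _] /eqP.
by rewrite !mulf_eq0 (negbTE a0) (lt_eqF vv).
Qed.

(** A null vector orthogonal to the null vector r is proportional to r. *)
Lemma sphere_of_tangent r : r != 0 -> b r r = 0 -> r \in (U :&: W)%VS ->
    (U :&: W <= orthov b <[r]>)%VS ->
  exists p, sphere_of b (U :&: W)%VS = [set p].
Proof.
move=> r0 rr rUW ro; exists (point_of r0); apply/seteqP; split=> [p|_ ->]; last first.
  exact: sphere_of_point.
case=> x [x0 xx xUW px]; apply: val_inj; rewrite [LHS]px /=.
apply/eqP; rewrite eqEdim !dim_vline r0 x0 andbT -memvE.
apply: (orthogonal_null_proportional b_nondeg b_index1) => //.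
by rewrite formC; apply/eqP; rewrite -mem_orthov1 (subvP ro).
Qed.

End MutualPosition.

(** * The classification of pairs of subspheres *)

Theorem theorem6 (R : realType) (n m l : nat) (V : vectType R)
    (b : {symmetric V}) (lt_mn : (m < n)%N) (le_lm : (l <= m)%N)
    (dimV : \dim {:V} = (n + 2)%N) (b_nondeg : nondegenerate b)
    (b_index1 : has_index b fullv 1) :
  (* (a) *)
  (forall (S1 S2 S1' S2' : set (proj_point V)) (W U W' U' : {vspace V})
      (alpha alpha' : (n - m).-tuple R),
    defines_sphere b m W S1 -> defines_sphere b l U S2 ->
    defines_sphere b m W' S1' -> defines_sphere b l U' S2' ->
    general_position b S1 S2 -> general_position b S1' S2' ->
    eigenvalue_list (pair_operator b W U) alpha ->
    eigenvalue_list (pair_operator b W' U') alpha' ->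
    (exists g, [/\ moebius_group b g, g @` S1 = S1' & g @` S2 = S2']) <->
    (forall i, tnth alpha i = tnth alpha' i))
  /\
  (* (b) *)
  (forall (S1 S2 : set (proj_point V)) (W U : {vspace V}) (alpha1 : R),
    defines_sphere b m W S1 -> defines_sphere b l U S2 ->
    general_position b S1 S2 ->
    largest_eigenvalue (pair_operator b W U) alpha1 ->
    [/\ (1 < alpha1 <-> euclidean b (U :&: W)%VS) /\
        (1 < alpha1 ->
           S1 `&` S2 = set0 /\
           exists Sigma1 Sigma2 : set (proj_point V),
             [/\ hypersphere b Sigma1, hypersphere b Sigma2,
                 S1 `<=` Sigma1, S2 `<=` Sigma2 & Sigma1 `&` Sigma2 = set0]),
        (alpha1 < 1 /\ (2 <= \dim (U :&: W))%N <->
           pseudo_euclidean b (U :&: W)%VS /\ (2 <= \dim (U :&: W))%N) /\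
        (alpha1 < 1 /\ (2 <= \dim (U :&: W))%N ->
           (n <= m + l)%N /\ subsphere b (m + l - n) (S1 `&` S2)),
        (alpha1 < 1 /\ \dim (U :&: W) = 1%N <->
           pseudo_euclidean b (U :&: W)%VS /\ \dim (U :&: W) = 1%N) /\
        (alpha1 < 1 /\ \dim (U :&: W) = 1%N ->
           [/\ (m + l = n - 1)%N, S1 `&` S2 = set0 &
               (* on a circle (n = 1) hyperspheres are point pairs, so that
                  Sigma1 = S1 and Sigma2 = S2 are disjoint *)
               (1 < n)%N ->
               ~ exists Sigma1 Sigma2 : set (proj_point V),
                   [/\ hypersphere b Sigma1, hypersphere b Sigma2,
                       S1 `<=` Sigma1, S2 `<=` Sigma2 &
                       Sigma1 `&` Sigma2 = set0]]) &
        (alpha1 = 1 <-> isotropic b (U :&: W)%VS) /\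
        (alpha1 = 1 -> exists p, S1 `&` S2 = [set p])]).
Proof.
have dimV3 : (2 < \dim {:V})%N by rewrite dimV; lia.
have pseudoP Y : pseudo_euclidean b Y -> nondegenerate_on b Y by case.
have perp_pos Y : pseudo_euclidean b Y -> euclidean b (orthov b Y).
  exact: orthov_pseudo_euclidean.
split.
  move=> S1 S2 S1' S2' W U W' U' alpha alpha'.
  move=> [Wp dW ->] [Up dU ->] [Wp' dW' ->] [Up' dU' ->] gp gp' ea ea'.
  have [Wn Un Wn' Un'] := And4 (pseudoP _ Wp) (pseudoP _ Up) (pseudoP _ Wp') (pseudoP _ Up').
  split=> [[g [[[f f0 fg] gM] gW gU]] i|alphaE].
    have [c c0 cf] := null_cone_conformal b_nondeg b_index1 f0 (induced_null f0 fg gM).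
    have fW : (f @: W)%VS = W'.
      by apply: induced_subspace fg _ _ _ gW; rewrite ?dW ?dW' ?addn2.
    have fU : (f @: U)%VS = U'.
      by apply: induced_subspace fg _ _ _ gU; rewrite ?dU ?dU' ?addn2.
    have : eigenvalue_list (pair_operator b W' U') alpha.
      rewrite -fW -fU; apply: (conformal_eigenvalue_list b_nondeg f0 c0 cf) => //;
        rewrite ?fW ?fU //; exact: perp_pos.
    by move/eigenvalue_list_unique/(_ ea')/val_inj->.
  have {alphaE} alphaE : alpha = alpha' by apply: eq_from_tnth.
  have [es [on eig esE]] := eigenvalue_listP b_nondeg Wn Un (perp_pos _ Wp) ea.
  have [es' [on' eig' esE']] := eigenvalue_listP b_nondeg Wn' Un' (perp_pos _ Wp') ea'.
  have sz : size es = size es'.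
    by rewrite -(size_map (fun e => b (perp2 b W U e) e)) esE alphaE -esE' size_map.
  have z1 : unzip1 (zip es es') = es by rewrite unzip1_zip ?sz.
  have z2 : unzip2 (zip es es') = es' by rewrite unzip2_zip ?sz.
  have [] := isometry_of_pairs (eps := zip es es') b_nondeg Wn Un Wn' Un';
    rewrite ?z1 ?z2 ?dU ?dU' //; try exact: perp_pos.
  - exact: general_position_orthov gp.
  - exact: general_position_orthov gp'.
  - have : map (fun e => b (perp2 b W U e) e) (unzip1 (zip es es'))
        = map (fun e => b (perp2 b W' U' e) e) (unzip2 (zip es es')).
      by rewrite z1 z2 esE esE' alphaE.
    by rewrite /unzip1 /unzip2 -!map_comp => /eq_in_map h p pz; apply: (h p).
  move=> f [isof fW fU].
  have [g gM fg] := isometric_moebius b_nondeg isof.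
  have f0 := isometric_inj b_nondeg isof.
  have im Y : g @` sphere_of b Y = sphere_of b (f @: Y).
    exact: (image_sphere_of _ f0 (oner_neq0 R) (isometric_conformal isof) fg).
  by exists g; rewrite !im fW fU.
move=> S1 S2 W U alpha1 [Wp dW ->] [Up dU ->] gp [alpha1_eig alpha1_max].
have WU0 := general_position_orthov b_nondeg b_index1 dimV3 Wp gp.
have dUW := dim_cap_general_position b_nondeg WU0.
have /leigenvalueP[e [eW e0 e_eig]] := alpha1_eig.
pose r := e - perp b U e.
have gt1 : 1 < alpha1 -> euclidean b (U :&: W)%VS.
  move=> a1; apply: (euclideanS (remnant_orthogonal U eW)).
  exact: (remnant_negative_euclidean b_nondeg b_index1 Wp Up eW e0 e_eig a1).
have eq1 : alpha1 = 1 -> r \in (U :&: W)%VS /\ b r r = 0.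
  exact: (remnant_tangent b_nondeg Wp Up eW e_eig).
have r0 : r != 0 by apply: remnant_neq0 eW e0.
have ro : (U :&: W <= orthov b <[r]>)%VS by apply: remnant_orthogonal eW.
have lt1 : alpha1 < 1 -> pseudo_euclidean b (U :&: W)%VS.
  move=> a1; apply: small_eigenvalues_pseudo_euclidean => // c /alpha1_max ca.
  exact: le_lt_trans ca a1.
have iso1 : alpha1 = 1 -> isotropic b (U :&: W)%VS.
  move=> /eq1[rUW rr] nd; case/negP: r0; rewrite -memv0 -nd memv_cap rUW /=.
  by apply/mem_orthovP => x /(subvP ro); rewrite mem_orthov1 formC => /eqP.
have pseudo_lt1 : pseudo_euclidean b (U :&: W)%VS -> alpha1 < 1.
  move=> p; case: (ltgtP alpha1 1) => // [/gt1|/iso1].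
    by move/(pseudo_euclidean_not_euclidean b_nondeg b_index1 p).
  by case; case: p.
have capE : sphere_of b W `&` sphere_of b U = sphere_of b (U :&: W)%VS.
  exact: sphere_of_cap.
rewrite capE; split; split.
- split=> [|pos]; first exact: gt1.
  case: (ltgtP alpha1 1) => // [/lt1 p|/iso1[]].
    by case: (pseudo_euclidean_not_euclidean b_nondeg b_index1 p pos).
  exact: euclidean_nondegenerate.
- move=> a1; split; first exact/sphere_of_euclidean/gt1.
  exact: (separating_hyperspheres b_nondeg b_index1 Wp Up eW e0 e_eig dimV3 a1).
- by split=> -[? ?]; split; auto.
- move=> [/lt1 p dge2]; have nml : (n <= m + l)%N by lia.
  by split=> //; exists (U :&: W)%VS; split=> //; lia.
- by split=> -[? ?]; split; auto.
- move=> [/lt1 p d1]; split; [lia|exact: sphere_of_pseudo_line|].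
  move=> n1 [Sigma1 [Sigma2 [h1 h2 s1 s2]]].
  by apply: (interlaced_hyperspheres b_nondeg b_index1 Wp Up _ _ _ p h1 h2 s1 s2); lia.
- split=> [|iso]; first exact: iso1.
  case: (ltgtP alpha1 1) => // [/lt1[]//|/gt1 pos].
  by case: iso; apply: euclidean_nondegenerate.
- move=> /eq1[rUW rr]; exact: (sphere_of_tangent b_nondeg b_index1 r0 rr rUW ro).
Qed.
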